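(* Let $n\ge1$. Zero is the only weak solution $\phi=\phi(\xi,t)$, $(\xi,t)\in\mathbb R^n\times\mathbb R$, to $$\partial_t\phi-\frac{\xi}{t-i}\cdot\nabla\phi-\frac{n}{t-i}\,\phi+i|\xi|^2\phi=0\quad\text{in }\mathbb R^{n+1}$$ verifying $$\sup_{t\in\mathbb R}\frac{\|\phi(t)\|_{L^2(\mathbb R^n)}}{(1+t^2)^{n/4}}<+\infty .$$
   Context: Here $i$ is the imaginary unit, $\phi$ is complex-valued and measurable on $\mathbb R^{n+1}$, $\phi(t)=\phi(\cdot,t)\in L^2(\mathbb R^n)$, and $\nabla$ is the gradient in the variable $\xi\in\mathbb R^n$. ''Weak solution'' means that the equation holds in the sense of distributions on $\mathbb R^{n+1}$, i.e. $$\int_{\mathbb R^{n+1}}\phi\left(-\partial_t\Theta+\frac{\xi}{t-i}\cdot\nabla\Theta+i|\xi|^2\Theta\right)d\xi\,dt=0\quad\text{for all }\Theta\in C_0^\infty(\mathbb R^{n+1},\mathbb R).$$ (The zeroth order term $-\frac{n}{t-i}\phi$ has been absorbed using $\xi\cdot\nabla\phi+n\phi=\nabla\cdot(\xi\phi)$.) Functions on $\mathbb R^{n+1}$ that agree almost everywhere are identified, so the conclusion is $\phi=0$ almost everywhere. *)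

(* Defs.v *)
From HB Require Import structures.
From mathcomp Require Import all_boot all_order all_algebra complex.
From mathcomp Require Import all_classical all_reals all_analysis.
From mathcomp Require Import measurable_realfun.

Set Implicit Arguments.
Unset Strict Implicit.
Unset Printing Implicit Defensive.
Import Order.TTheory GRing.Theory Num.Theory.
Import numFieldNormedType.Exports.

Local Open Scope classical_set_scope.
Local Open Scope ring_scope.

Section measurable_rV.
Variables (R : realType) (n : nat).

Definition rV_coor (i : 'I_n) (v : 'rV[R]_n) : R := v ord0 i.

Let rV_set0 : g_sigma_preimage rV_coor set0.
Proof. exact: sigma_algebra0. Qed.

Let rV_setC A : g_sigma_preimage rV_coor A -> g_sigma_preimage rV_coor (~` A).
Proof. exact: sigma_algebraC. Qed.

Let rV_bigcup (F : (set 'rV[R]_n)^nat) :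
  (forall i, g_sigma_preimage rV_coor (F i)) ->
  g_sigma_preimage rV_coor (\bigcup_i (F i)).
Proof. exact: sigma_algebra_bigcup. Qed.

(* Generated by the coordinates, hence the Borel sigma-algebra of R^n. *)
HB.instance Definition _ := @isMeasurable.Build default_measure_display
  'rV[R]_n (g_sigma_preimage rV_coor) rV_set0 rV_setC rV_bigcup.

Lemma measurable_rV_coor i : measurable_fun [set: 'rV[R]_n] (rV_coor i).
Proof.
move=> _ Y mY; rewrite setTI; apply: sub_sigma_algebra => /=.
rewrite -bigcup_seq/=; exists i => /=; first by rewrite mem_index_enum.
by exists Y => //; rewrite setTI.
Qed.

Lemma measurable_fun_rVP d (T : measurableType d) (f : T -> 'rV[R]_n) :
  (forall i, measurable_fun [set: T] (rV_coor i \o f)) ->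
  measurable_fun [set: T] f.
Proof.
move=> mf; apply: (@measurability _ _ _ _ setT f
  (\big[setU/set0]_(i < n) preimage_set_system setT (rV_coor i) measurable)) => //.
move=> _ [B + <-]; rewrite -bigcup_seq/= => -[i _ [C mC <-]].
by rewrite setTI; exact: mf.
Qed.

End measurable_rV.

Definition rV_cons {R : realType} {n : nat} (p : R * 'rV[R]_n) : 'rV[R]_n.+1 :=
  row_mx (const_mx p.1 : 'rV_1) p.2.

Lemma rV_cons0 (R : realType) n (p : R * 'rV[R]_n) : rV_cons p ord0 ord0 = p.1.
Proof.
transitivity (row_mx (const_mx p.1 : 'rV_1) p.2 ord0 (lshift n ord0)).
  by congr (row_mx _ _ _ _); exact/val_inj.
by rewrite row_mxEl mxE.
Qed.

Lemma rV_consS (R : realType) n (p : R * 'rV[R]_n) (i : 'I_n) :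
  rV_cons p ord0 (lift ord0 i) = p.2 ord0 i.
Proof.
rewrite -(row_mxEr (const_mx p.1 : 'rV_1) p.2 ord0 i).
by congr (row_mx _ _ _ _); exact/val_inj.
Qed.

Lemma measurable_rV_cons (R : realType) n :
  measurable_fun [set: R * 'rV[R]_n] (@rV_cons R n).
Proof.
apply: measurable_fun_rVP => i; case: (unliftP ord0 i) => [j ->|->].
  rewrite (_ : _ \o _ = rV_coor j \o snd); last first.
    by apply/funext => p /=; rewrite /rV_coor rV_consS.
  by apply: measurableT_comp => //; exact: measurable_rV_coor.
rewrite (_ : _ \o _ = fst) //.
by apply/funext => p /=; rewrite /rV_coor rV_cons0.
Qed.

Section rV_cons_measure.
Variables (R : realType) (n : nat).
Variable mu : {sigma_finite_measure set 'rV[R]_n -> \bar R}.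

Definition rV_cons_measure : set 'rV[R]_n.+1 -> \bar R :=
  pushforward (lebesgue_measure \x mu)%E rV_cons.

Let m0 : rV_cons_measure set0 = 0%E.
Proof. by rewrite /rV_cons_measure /pushforward preimage_set0 measure0. Qed.

Let m_ge0 A : (0 <= rV_cons_measure A)%E.
Proof. exact: (measure_ge0 (lebesgue_measure \x mu)%E). Qed.

Let m_sigma_additive : semi_sigma_additive rV_cons_measure.
Proof.
apply: (@measure_semi_sigma_additive _ _ _
  (pushforward (lebesgue_measure \x mu)%E (@rV_cons R n))).
exact: measurable_rV_cons.
Qed.

HB.instance Definition _ := isMeasure.Build _ _ _ rV_cons_measure
  m0 m_ge0 m_sigma_additive.

Let m_sigma_finite : sigma_finite setT rV_cons_measure.
Proof.
have [F TF Foo] : sigma_finite setT (lebesgue_measure \x mu)%E.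
  have /sigma_finiteP[F [TF ndF Foo]] := sigma_finiteT (@lebesgue_measure R).
  have /sigma_finiteP[G [TG ndG Goo]] := sigma_finiteT mu.
  exists (fun k => F k `*` G k).
    rewrite -setXTT TF TG; apply/seteqP; split; last first.
      by move=> p [k _ [Fp Gp]]; split; exists k.
    move=> [x y] [/= [i _ Fx] [j _ Gy]]; exists (maxn i j) => //; split.
      by move: x Fx; exact/subsetPset/ndF/leq_maxl.
    by move: y Gy; exact/subsetPset/ndG/leq_maxr.
  move=> k; have [mFk Fkoo] := Foo k; have [mGk Gkoo] := Goo k.
  split; first exact: measurableX.
  by rewrite product_measure1E// lte_mul_pinfty// ge0_fin_numE.
pose uncons (v : 'rV[R]_n.+1) : R * 'rV[R]_n :=
  (v ord0 ord0, \row_j v ord0 (lift ord0 j)).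
have consK : cancel (@rV_cons R n) uncons.
  move=> [x v]; rewrite /uncons rV_cons0 /=; congr pair.
  by apply/rowP => j; rewrite mxE; exact: rV_consS.
have muncons : measurable_fun setT uncons.
  apply/measurable_fun_pairP; split => /=.
    exact: measurable_rV_coor.
  apply: measurable_fun_rVP => i.
  rewrite (_ : _ \o _ = rV_coor (lift ord0 i)); first exact: measurable_rV_coor.
  by apply/funext => v /=; rewrite /rV_coor mxE.
exists (fun k => uncons @^-1` F k).
  by rewrite -preimage_bigcup -TF preimage_setT.
move=> k; split; first by rewrite -[X in measurable X]setTI; exact: muncons (Foo k).1.
rewrite /rV_cons_measure /pushforward -comp_preimage.
by rewrite (_ : uncons \o rV_cons = id) ?preimage_id ?(Foo k).2//; apply/funext.
Qed.

HB.instance Definition _ := Measure_isSigmaFinite.Build _ _ _ rV_cons_measure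
  m_sigma_finite.

End rV_cons_measure.

(* Iterated product of lebesgue_measure; lebesgue_rV_box gives its values on
   boxes, which determine it. *)
Fixpoint lebesgue_rV (R : realType) (n : nat) :
    {sigma_finite_measure set 'rV[R]_n -> \bar R} :=
  match n with
  | 0 => @dirac _ 'rV[R]_0 0 R
  | n'.+1 => rV_cons_measure (lebesgue_rV R n')
  end.

Lemma lebesgue_rV_box (R : realType) (n : nat) (A : 'I_n -> set R) :
  (forall i, measurable (A i)) ->
  lebesgue_rV R n [set v | forall i, A i (v ord0 i)] =
  (\prod_(i < n) (lebesgue_measure (A i)))%E.
Proof.
elim: n A => [|n IH] A mA.
  rewrite big_ord0 (_ : [set v | _] = setT) /=; first by rewrite diracT.
  by apply/seteqP; split => // v _ [].
rewrite big_ord_recl -IH//.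
have mB : measurable [set v : 'rV[R]_n | forall i : 'I_n, A (lift ord0 i) (v ord0 i)].
  rewrite (_ : mkset _ =
      \bigcap_(i in [set: 'I_n]) (rV_coor i @^-1` A (lift ord0 i))); last first.
    by apply/seteqP; split => [v Av i _|v Av i]; [exact: Av|exact: Av].
  apply: fin_bigcap_measurable => [|i _]; first exact: finite_finset.
  by rewrite -[X in measurable X]setTI;
    exact: (@measurable_rV_coor R n i measurableT _ (mA _)).
transitivity ((lebesgue_measure \x lebesgue_rV R n)%E (A ord0 `*`
    [set v : 'rV[R]_n | forall i : 'I_n, A (lift ord0 i) (v ord0 i)])).
  rewrite /= /rV_cons_measure /pushforward; congr (product_measure1 _ _ _).
  apply/seteqP; split => [p /= Ap|p /= [Ap0 ApS] i].
    split=> [|i]; first by rewrite -rV_cons0; exact: Ap.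
    by rewrite -rV_consS; exact: Ap.
  by case: (unliftP ord0 i) => [j ->|->]; [rewrite rV_consS|rewrite rV_cons0].
by rewrite product_measure1E//; exact: mA.
Qed.

Section lebesgue_measurability.
Context d (T : measurableType d) (R : realType).
Variable mu : {measure set T -> \bar R}.

(* For mu the Borel Lebesgue measure this is Lebesgue measurability, which is
   weaker than measurable_fun (Borel measurability). *)
Definition completed_measurable_fun (f : T -> R) : Prop :=
  forall B : set R, measurable B -> completed_algebra_gen mu (f @^-1` B).

Definition completed_measurable_cfun (f : T -> R[i]) : Prop :=
  completed_measurable_fun (fun x => complex.Re (f x)) /\
  completed_measurable_fun (fun x => complex.Im (f x)).

Definition cL2norm (f : T -> R[i]) : \bar R :=
  Lnorm mu 2%:E (fun x => (ComplexField.Normc.normc (f x))%:E).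

Definition in_cL2 (f : T -> R[i]) : Prop :=
  completed_measurable_cfun f /\ (cL2norm f < +oo)%E.

(* The library integral of a nonnegative function is the supremum of the
   integrals of the simple functions below it, so it has the right value on
   functions that are measurable only for the completion of mu. *)
Definition cintegral (f : T -> R[i]) : R[i] :=
  Complex (\int[mu]_x complex.Re (f x)) (\int[mu]_x complex.Im (f x)).

End lebesgue_measurability.

Section test_functions.
Variables (R : realType) (V : normedModType R).

(* In finite dimension, differentiability together with C^k directional
   derivatives amounts to C^(k+1). *)
Fixpoint Ck (k : nat) (f : V -> R) : Prop :=
  match k with
  | 0 => continuous f
  | k'.+1 => (forall x, differentiable f x) /\ (forall v, Ck k' ('D_v f))
  end.

Definition test_function (f : V -> R) : Prop :=
  (forall k, Ck k f) /\ compact (closure [set x | f x != 0]).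

End test_functions.

Section weak_solutions.
Variables (R : realType) (n : nat).
Implicit Types (phi : 'rV[R]_n * R -> R[i]) (Theta : 'rV[R]_n * R -> R).

Definition d_t Theta : 'rV[R]_n * R -> R := 'D_((0 : 'rV[R]_n), (1 : R)) Theta.

Definition d_xi (j : 'I_n) Theta : 'rV[R]_n * R -> R :=
  'D_((delta_mx ord0 j : 'rV[R]_n), (0 : R)) Theta.

Definition xi_dot_grad Theta (p : 'rV[R]_n * R) : R :=
  \sum_(j < n) p.1 ord0 j * d_xi j Theta p.

Definition sqr_norm (xi : 'rV[R]_n) : R := \sum_(j < n) xi ord0 j ^+ 2.

(* Formal adjoint of
     phi |-> d_t phi - xi/(t-i) . grad phi - n/(t-i) phi + i |xi|^2 phi,
   no zeroth-order term in n being left because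
     xi . grad phi + n phi = div (xi phi). *)
Definition adjoint_op Theta (p : 'rV[R]_n * R) : R[i] :=
  (- (d_t Theta p)%:C + (xi_dot_grad Theta p)%:C / (p.2 -i* 1)
   + (0 +i* 1) * (sqr_norm p.1)%:C * (Theta p)%:C)%C.

Definition lebesgue_spacetime :
    {measure set ('rV[R]_n * measurableTypeR R) -> \bar R} :=
  (lebesgue_rV R n \x lebesgue_measure)%E.

Definition weak_solution phi : Prop :=
  forall Theta, test_function Theta ->
    cintegral lebesgue_spacetime (fun p => phi p * adjoint_op Theta p) = 0.

End weak_solutions.

(* Main.v *)
Require Import Defs.
From HB Require Import structures.
From mathcomp Require Import all_boot all_order all_algebra complex.
From mathcomp Require Import all_classical all_reals all_analysis.
From mathcomp Require Import measurable_realfun ring lra.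

Set Implicit Arguments.
Unset Strict Implicit.
Unset Printing Implicit Defensive.
Import Order.TTheory GRing.Theory Num.Theory.
Import numFieldNormedType.Exports.

Local Open Scope classical_set_scope.
Local Open Scope ring_scope.

(** Put w = xi (t - i), a vector of C^n with |w|^2 = |xi|^2 (1 + t^2), and
    psi = phi / (t - i) = a + i b.  The field d_t - xi / (t - i) . grad kills
    the coordinates of w, so that along each ray the equation is a
    Cauchy-Riemann equation in w, and the adjoint operator kills the real
    Gaussian e^(- |w|^2 / 2).  Testing against this Gaussian times polynomials
    turns uniqueness into a determinate moment problem.

    Moments.  Test the equation with the product of a bump, the Gaussian and a
    monomial xi^s t^m of degree N in xi ([mul_adjoint_cutoff_test]).  When the
    bump tends to a constant, the moments
      I(m) = \int psi e^(- |w|^2 / 2) xi^s t^m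
    satisfy (N - m) I(m) + i m I(m - 1) = 0 ([moment_recurrence]), and for
    m < N this gives I(m) = 0 by induction on m ([moments_eq0]).  The growth
    assumption enters only through convergence: if m + 2 (n + 2) <= N, then
    xi^s t^m is at most (1 + t^2)^-(n + 2) times 1 + |w|^(2 N) ([mono_bound]),
    while the squared L^2 norm of the slice phi(t) is O((1 + t^2)^n); hence
    all the integrands have a common integrable majorant
    ([integrable_envelope], [domination_bound]).

    Density.  For a fixed j, the function
    g = psi e^(- |w|^2 / 2) xi_j^(2 (n + 2)) is therefore orthogonal to all
    polynomials in the xi_k and xi_k t.  The Gaussian makes g integrable
    against e^|l| for every affine form l in these variables, so polynomials
    may be replaced successively by sin l (Taylor series), by the sign of
    sin l (iterating s |-> (3 s - s^3) / 2, which tends boundedly to the sign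
    on [-1, 1]), and by the sign of l (rescaling l).  The sets whose
    indicators may be inserted in this way form a sigma-algebra
    ([sigma_algebra_stable_set]); it contains {xi_k > c}, and also {t > c}
    because g vanishes where xi_j does ([moments_ae0]).  So g has integral 0
    over every Borel set and vanishes almost everywhere, and so does phi.

    As phi is only measurable for the completed sigma-algebra, it is first
    replaced by a Borel function equal to it off a null set; the integral, a
    supremum over simple functions, does not see the difference
    ([ge0_eq_integral_null], [completed_measurable_restrict]). *)

(** * Smooth functions *)

Definition smooth (R : realType) (V : normedModType R) (f : V -> R) : Prop :=
  forall k, Ck k f.

Section smooth_functions.
Variables (R : realType) (V : normedModType R).
Implicit Types (f g : V -> R) (u : R -> R).

Lemma CkW k f : Ck k.+1 f -> Ck k f.
Proof.
elim: k f => [|k IH] f [df Cf].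
  by move=> x; exact: differentiable_continuous.
by split=> // v; exact/IH/Cf.
Qed.

Lemma smoothS f : (forall x, differentiable f x) ->
  (forall v, smooth ('D_v f)) -> smooth f.
Proof.
move=> df Df; case=> [x|k]; first exact: differentiable_continuous.
by split=> // v; exact: Df.
Qed.

Lemma Ck_cst k (c : R) : Ck k (fun _ : V => c).
Proof.
elim: k c => [|k IH] c; first by move=> x; exact: cvg_cst.
split=> [x|v]; first exact: differentiable_cst.
rewrite (_ : 'D_v _ = fun _ => 0); first exact: IH.
by apply/funext => x; exact: derive_cst.
Qed.

Lemma smooth_cst (c : R) : smooth (fun _ : V => c).
Proof. by move=> k; exact: Ck_cst. Qed.

Lemma CkD k f g : Ck k f -> Ck k g -> Ck k (fun x => f x + g x).
Proof.
elim: k f g => [|k IH] f g.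
  by move=> cf cg x; apply: cvgD; [exact: cf|exact: cg].
move=> [df Cf] [dg Cg]; split=> [x|v]; first exact: differentiableD.
rewrite (_ : 'D_v _ = fun x => 'D_v f x + 'D_v g x).
  by apply: IH; [exact: Cf|exact: Cg].
apply/funext => x; rewrite -[LHS]/('D_v (f + g) x).
by rewrite deriveD//; exact: diff_derivable.
Qed.

Lemma derive_mul f g x v : differentiable f x -> differentiable g x ->
  'D_v (fun y => f y * g y) x = 'D_v f x * g x + f x * 'D_v g x.
Proof.
move=> df dg; rewrite -[LHS]/('D_v (f * g) x).
rewrite deriveM; [|exact: diff_derivable|exact: diff_derivable].
by rewrite addrC; congr (_ + _); exact: mulrC.
Qed.

Lemma CkM k f g : Ck k f -> Ck k g -> Ck k (fun x => f x * g x).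
Proof.
elim: k f g => [|k IH] f g.
  by move=> cf cg x; apply: cvgM; [exact: cf|exact: cg].
move=> Cf' Cg'; have Cfk := CkW Cf'; have Cgk := CkW Cg'.
case: Cf' Cg' => [df Cf] [dg Cg]; split=> [x|v]; first exact: differentiableM.
rewrite (_ : 'D_v _ = fun x => 'D_v f x * g x + f x * 'D_v g x).
  by apply: CkD; apply: IH => //; [exact: Cf|exact: Cg].
by apply/funext => x; exact: derive_mul.
Qed.

Lemma smoothD f g : smooth f -> smooth g -> smooth (fun x => f x + g x).
Proof. by move=> sf sg k; exact: CkD. Qed.

Lemma smoothM f g : smooth f -> smooth g -> smooth (fun x => f x * g x).
Proof. by move=> sf sg k; exact: CkM. Qed.

Lemma derive_comp1 u f x v : differentiable f x -> differentiable u (f x) ->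
  'D_v (fun y => u (f y)) x = 'D_1 u (f x) * 'D_v f x.
Proof.
move=> df du; rewrite -[X in 'D_v X x]/(u \o f).
rewrite !deriveE//; last exact: differentiable_comp.
rewrite diff_comp//= [X in _ = _ * X](_ : _ = 'd f x v)// -{1}['d f x v]mulr1.
by rewrite -[_ * 1]/(_ *: _) linearZ mulrC.
Qed.

Lemma Ck_comp k u f : Ck k u -> Ck k f -> Ck k (fun x => u (f x)).
Proof.
elim: k u f => [|k IH] u f.
  by move=> cu cf x; apply: continuous_comp; [exact: cf|exact: cu].
move=> [du Cu] Cf'; have Cfk := CkW Cf'; case: Cf' => [df Cf].
split=> [x|v]; first exact: differentiable_comp.
rewrite (_ : 'D_v _ = fun x => 'D_1 u (f x) * 'D_v f x).
  by apply: CkM; [exact: (IH ('D_1 u) f (Cu 1) Cfk)|exact: Cf].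
by apply/funext => x; exact: derive_comp1.
Qed.

Lemma smooth_comp u f : smooth u -> smooth f -> smooth (fun x => u (f x)).
Proof. by move=> su sf k; exact: Ck_comp. Qed.

(** For the coordinates: their derivatives along a fixed vector are constant. *)
Lemma smooth_linear f : (forall x, differentiable f x) ->
  (forall v x y, 'D_v f x = 'D_v f y) -> smooth f.
Proof.
move=> df cf; apply: smoothS => // v.
rewrite (_ : 'D_v f = fun _ => 'D_v f 0); first exact: smooth_cst.
by apply/funext => x; exact: cf.
Qed.

Lemma smooth_sum (I : Type) (r : seq I) (F : I -> V -> R) :
  (forall i, smooth (F i)) -> smooth (fun x => \sum_(i <- r) F i x).
Proof.
move=> sF; elim: r => [|i r IH].
  rewrite (_ : (fun _ => _) = fun _ => 0); first exact: smooth_cst.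
  by apply/funext => x; rewrite big_nil.
rewrite (_ : (fun _ => _) = fun x => F i x + \sum_(j <- r) F j x).
  exact: smoothD.
by apply/funext => x; rewrite big_cons.
Qed.

Lemma smooth_prod (I : Type) (r : seq I) (F : I -> V -> R) :
  (forall i, smooth (F i)) -> smooth (fun x => \prod_(i <- r) F i x).
Proof.
move=> sF; elim: r => [|i r IH].
  rewrite (_ : (fun _ => _) = fun _ => 1); first exact: smooth_cst.
  by apply/funext => x; rewrite big_nil.
rewrite (_ : (fun _ => _) = fun x => F i x * \prod_(j <- r) F j x).
  exact: smoothM.
by apply/funext => x; rewrite big_cons.
Qed.

Lemma smoothX f m : smooth f -> smooth (fun x => f x ^+ m).
Proof.
move=> sf; elim: m => [|m IH].
  by rewrite (_ : (fun _ => _) = fun _ => 1); [exact: smooth_cst|].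
rewrite (_ : (fun _ => _) = fun x => f x * f x ^+ m); first exact: smoothM.
by apply/funext => x; rewrite exprS.
Qed.

End smooth_functions.

(** * A smooth bump *)

Lemma expn_le_expR (R : realType) (x : R) (m : nat) :
  0 <= x -> x ^+ m <= m`!%:R * expR x.
Proof.
move=> x0; case: m => [|m].
  by rewrite fact0 mul1r expr0 -expR0 ler_expR.
rewrite mulrC -ler_pdivrMr ?ltr0n ?fact_gt0//.
by apply: le_trans (expR_ge1Dxn m x0); rewrite lerDr.
Qed.

Section flat_functions.
Variable R : realType.
Implicit Types (x y : R) (m : nat).

(** The functions y^-m e^(-1/y) are needed for all m: differentiating one of them
    gives a combination of two others, so they are smooth simultaneously. *)
Definition flat m y : R := if 0 < y then y^-1 ^+ m * expR (- y^-1) else 0.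

Lemma flat_ge0 m y : 0 <= flat m y.
Proof.
rewrite /flat; case: ifPn => // y0.
by rewrite mulr_ge0 ?expR_ge0// exprn_ge0// invr_ge0 ltW.
Qed.

Lemma flat_le_fact m y : flat m y <= m`!%:R.
Proof.
rewrite /flat; case: ifPn => // y0; rewrite expRN ler_pdivrMr ?expR_gt0//.
by apply: expn_le_expR; rewrite invr_ge0 ltW.
Qed.

(** Gives the derivative 0 at the origin for the whole family. *)
Lemma flat_le_sqr m y : flat m y <= m.+2`!%:R * y ^+ 2.
Proof.
have [y0|y0] := boolP (0 < y); last first.
  by rewrite /flat (negbTE y0) mulr_ge0// sqr_ge0.
rewrite -ler_pdivrMr ?exprn_gt0//.
apply: le_trans (flat_le_fact m.+2 y); rewrite /flat y0.
by rewrite -exprVn !exprS expr0; lra.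
Qed.

Lemma is_derive_flat m y :
  is_derive y 1 (flat m) (- m%:R * flat m.+1 y + flat m.+2 y).
Proof.
have [y0|y0|->] := ltgtP y 0.
- rewrite /flat !(lt_gtF y0) ?mulr0 ?addr0.
  apply: (@near_eq_is_derive _ _ _ (fun _ => 0)).
  near=> z; rewrite (_ : 0 < z = false)//; apply/negbTE; rewrite -leNgt ltW//.
  by near: z; exact: lt_nbhsl.
- rewrite /flat y0.
  have nE : \forall z \near y, (fun z => z^-1 ^+ m * expR (- z^-1)) z =
      if 0 < z then z^-1 ^+ m * expR (- z^-1) else 0.
    near=> z; rewrite /= (_ : 0 < z = true)//.
    by near: z; exact: lt_nbhsr.
  (* Off the origin the formula can be differentiated directly. *)
  have dV : is_derive y 1 (fun z : R => z^-1) (- y ^- 2 *: 1).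
    by apply: (@is_deriveV _ id); rewrite gt_eqF.
  have dE : is_derive y 1 (fun z : R => expR (- z^-1))
      (expR (- y^-1) * - (- y ^- 2 *: 1)).
    exact: (@is_derive1_comp _ expR (fun z => - z^-1)).
  have dX : is_derive y 1 (fun z : R => z^-1 ^+ m)
      (m%:R * y^-1 ^+ m.-1 * - y ^- 2).
    rewrite (_ : (fun _ => _) = (fun z : R => z^-1) ^+ m); last first.
      by apply/funext => z; rewrite exprfctE.
    apply: DeriveDef; first by have [] := @is_deriveX _ _ _ m _ _ _ dV.
    by have [_ ->] := @is_deriveX _ _ _ m _ _ _ dV; rewrite /= [_%:A]mulr1.
  have [dM eM] := @is_deriveM _ _ _ _ _ _ _ _ dX dE.
  apply: (near_eq_is_derive nE); apply: DeriveDef; first exact: dM.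
  rewrite -[LHS]/('D_1 ((fun z => z^-1 ^+ m) * (fun z : R => expR (- z^-1))) y).
  rewrite eM /= [_%:A]mulr1.
  rewrite -![_ *: _]/(_ * _) -exprVn.
  case: (m) => [|k] /=; rewrite ?exprS; ring.
- rewrite /flat ltxx mulr0 addr0.
  have cv0 : (fun h : R => h^-1 *: ((flat m \o shift 0) (h *: 1) - flat m 0)) @ 0^' --> 0.
    apply/cvgr0Pnorm_le => e e0.
    have f0 : 0 < m.+2`!%:R :> R by rewrite ltr0n fact_gt0.
    near=> h.
    have h0 : h != 0 by near: h; exact: nbhs_dnbhs_neq.
    have he : `|h| <= e / m.+2`!%:R.
      by near: h; apply: dnbhs0_le; rewrite divr_gt0.
    rewrite /= {2}/flat ltxx subr0 addr0 [h *: 1]mulr1.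
    rewrite normrZ normfV (ger0_norm (flat_ge0 _ _)) mulrC ler_pdivrMr ?normr_gt0//.
    apply: le_trans (flat_le_sqr m h) _.
    by rewrite -real_normK ?num_real// expr2 mulrA ler_wpM2r// mulrC -ler_pdivlMr.
  apply: DeriveDef; first by apply/cvg_ex; exists 0.
  exact: cvg_lim cv0.
Unshelve. all: by end_near. Qed.
End flat_functions.

Section smooth_real_functions.
Variable R : realType.
Implicit Types (u : R -> R).

Lemma is_derive_dir u (du x v : R) : is_derive x 1 u du ->
  differentiable u x /\ 'D_v u x = v * du.
Proof.
move=> [du1 du2]; have dif : differentiable u x by exact/derivable1_diffP.
split=> //; rewrite deriveE// -du2 deriveE//.
by rewrite -[in LHS](mulr1 v) -[v * 1]/(v *: 1) linearZ.
Qed.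

Lemma smooth_flat m : smooth (@flat R m).
Proof.
move=> k; elim: k m => [|k IH] m.
  by move=> x; apply: differentiable_continuous;
    exact: (is_derive_dir 0 (is_derive_flat m x)).1.
split=> [x|v]; first exact: (is_derive_dir 0 (is_derive_flat m x)).1.
rewrite (_ : 'D_v _ = fun y => v * (- m%:R * flat m.+1 y + flat m.+2 y)).
  apply: CkM; first exact: Ck_cst.
  by apply: CkD => //; apply: CkM => //; exact: Ck_cst.
by apply/funext => y; exact: (is_derive_dir v (is_derive_flat m y)).2.
Qed.

Lemma smooth_expR : smooth (@expR R).
Proof.
move=> k; elim: k => [|k IH].
  by move=> x; exact: continuous_expR.
split=> [x|v]; first exact: (is_derive_dir 0 (is_derive_expR x)).1.
rewrite (_ : 'D_v _ = fun y => v * expR y).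
  by apply: CkM => //; exact: Ck_cst.
by apply/funext => y; exact: (is_derive_dir v (is_derive_expR y)).2.
Qed.

End smooth_real_functions.

(** * Directional derivatives in spacetime *)

Section directional.
Variables (R : realType) (V : normedModType R).
Implicit Types (f g : V -> R) (p v : V).

(** Differentiability and the value of the derivative are kept together so that
    the rules of calculus compose without side conditions. *)
Definition has_derive f p v d := differentiable f p /\ 'D_v f p = d.

Lemma has_derive_eq f p v d e : has_derive f p v d -> d = e -> has_derive f p v e.
Proof. by move=> ? <-. Qed.

Lemma has_derive_cst c p v : has_derive (fun _ => c) p v 0.
Proof. by split; [exact: differentiable_cst|exact: derive_cst]. Qed.

Lemma has_deriveD f g p v d e : has_derive f p v d -> has_derive g p v e ->
  has_derive (fun q => f q + g q) p v (d + e).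
Proof.
move=> [df <-] [dg <-]; split; first exact: differentiableD.
by rewrite -[LHS]/('D_v (f + g) p) deriveD//; exact: diff_derivable.
Qed.

Lemma has_deriveM f g p v d e : has_derive f p v d -> has_derive g p v e ->
  has_derive (fun q => f q * g q) p v (d * g p + f p * e).
Proof.
by move=> [df <-] [dg <-]; split; [exact: differentiableM|exact: derive_mul].
Qed.

Lemma has_derive_comp (u : R -> R) f p v d e : is_derive (f p) 1 u e ->
  has_derive f p v d -> has_derive (fun q => u (f q)) p v (e * d).
Proof.
move=> du [df <-]; have [dfu du1] := is_derive_dir 1 du.
split; first exact: differentiable_comp.
by rewrite derive_comp1// du1 mul1r.
Qed.

Lemma has_deriveX f p v d m : has_derive f p v d ->
  has_derive (fun q => f q ^+ m) p v (m%:R * f p ^+ m.-1 * d).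
Proof.
move=> fd; elim: m => [|m IH].
  by rewrite !mul0r; apply: has_derive_cst.
rewrite (_ : (fun _ => _) = fun q => f q * f q ^+ m); last first.
  by apply/funext => q; rewrite exprS.
apply: has_derive_eq (has_deriveM fd IH) _.
by case: m {IH} => [|m]; rewrite /= ?exprS ?[m.+2%:R]mulrS ?[m.+1%:R]mulrS; ring.
Qed.

Lemma has_derive_sum (I : Type) (r : seq I) (F : I -> V -> R) (d : I -> R) p v :
  (forall i, has_derive (F i) p v (d i)) ->
  has_derive (fun q => \sum_(i <- r) F i q) p v (\sum_(i <- r) d i).
Proof.
move=> Fd; elim: r => [|i r IH].
  rewrite big_nil (_ : (fun _ => _) = fun _ => 0); first exact: has_derive_cst.
  by apply/funext => q; rewrite big_nil.
rewrite big_cons (_ : (fun _ => _) = fun q => F i q + \sum_(j <- r) F j q).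
  exact: has_deriveD.
by apply/funext => q; rewrite big_cons.
Qed.

End directional.

Section spacetime.
Variables (R : realType) (n : nat).
Local Notation V := ('rV[R]_n * R)%type.
Implicit Types (p v : V) (f : V -> R).

Lemma has_derive_coord (j : 'I_n) p v : has_derive (fun q : V => q.1 ord0 j) p v (v.1 ord0 j).
Proof.
pose l (q : V) : R := q.1 ord0 j.
have linl : linear l by move=> a x y; rewrite /l /= !mxE.
pose lM := GRing.isLinear.Build _ _ _ _ _ linl.
pose L : {linear V -> R} := HB.pack l lM.
have cL : continuous L.
  move=> x; apply: (@continuous_comp _ _ _ fst (fun w : 'rV[R]_n => w ord0 j)).
    exact: cvg_fst.
  exact: coord_continuous.
rewrite -[X in has_derive X]/(L : V -> R); have dL := @linear_differentiable _ _ _ L p cL.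
by split=> //; rewrite deriveE// diff_lin.
Qed.

Lemma has_derive_time p v : has_derive (fun q : V => q.2) p v v.2.
Proof.
pose l (q : V) : R := q.2.
have linl : linear l by [].
pose lM := GRing.isLinear.Build _ _ _ _ _ linl.
pose L : {linear V -> R} := HB.pack l lM.
have cL : continuous L by move=> x; exact: cvg_snd.
rewrite -[X in has_derive X]/(L : V -> R); have dL := @linear_differentiable _ _ _ L p cL.
by split=> //; rewrite deriveE// diff_lin.
Qed.

Lemma smooth_coord (j : 'I_n) : smooth (fun q : V => q.1 ord0 j).
Proof.
apply: smooth_linear => [x|v x y]; first exact: (has_derive_coord j x 0).1.
by rewrite (has_derive_coord j x v).2 (has_derive_coord j y v).2.
Qed.

Lemma smooth_time : smooth (fun q : V => q.2).
Proof.
apply: smooth_linear => [x|v x y]; first exact: (has_derive_time x 0).1.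
by rewrite (has_derive_time x v).2 (has_derive_time y v).2.
Qed.

(** By linearity of the differential, the Euler field is one directional
    derivative, along (xi, 0). *)
Lemma xi_dot_gradE f p : differentiable f p ->
  xi_dot_grad f p = 'D_((p.1, 0) : V) f p.
Proof.
move=> df; rewrite deriveE// [in RHS](row_sum_delta p.1).
have addh : {morph (fun w : 'rV[R]_n => 'd f p (w, 0)) : x y / x + y}.
  move=> x y; rewrite -linearD; congr ('d f p _).
  by rewrite -[RHS]/(x + y, 0 + 0) addr0.
have h0 : 'd f p ((0 : 'rV[R]_n), 0 : R) = 0 by exact: (linear0 ('d f p)).
rewrite (big_morph _ addh h0); apply: eq_bigr => j _.
rewrite /d_xi deriveE// -[_ * _]/(_ *: _) -linearZ; congr ('d f p _).
by rewrite -[LHS]/(_ *: _, _ *: 0) scaler0.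
Qed.

End spacetime.

(** * Test functions: bump times Gaussian times monomial *)

Section test_functions.
Variables (R : realType) (n : nat).
Local Notation V := ('rV[R]_n * R)%type.
Implicit Types (p v : V) (f : V -> R) (s : seq 'I_n) (m k : nat).

(** The multi-index is a sequence with repetitions, so that its degree is size s
    and multiplying by a coordinate is consing. *)
Definition mono s m p : R := (\prod_(j <- s) p.1 ord0 j) * p.2 ^+ m.

(** This is e^(- |w|^2 / 2) with w = xi (t - i); it is killed by the adjoint operator. *)
Definition ground p : R := expR (- (sqr_norm p.1 * (1 + p.2 ^+ 2) / 2)).

(** The cutoff is the case e = 0; the case e = 2 comes from its derivative. *)
Definition bump e k p : R :=
  flat e (1 - (sqr_norm p.1 + p.2 ^+ 2) / k.+1%:R).

Definition cutoff_test s m k p : R := bump 0 k p * (ground p * mono s m p).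

(** The fields d_t and xi . grad are both derivatives along (lam xi, tau) at the
    point (xi, t), and monomials are eigenfunctions of the latter field, which is
    why all derivatives are computed along such vectors only. *)
Section radial_derivatives.
Variables (p : V) (lam tau : R).
Let v : V := (lam *: p.1, tau).

Lemma has_derive_sqr_norm : has_derive (fun q : V => sqr_norm q.1) p v
  (2 * lam * sqr_norm p.1).
Proof.
apply: has_derive_eq (@has_derive_sum _ _ _ _ (fun j (q : V) => q.1 ord0 j ^+ 2)
  (fun j => 2 * lam * p.1 ord0 j ^+ 2) _ _ _) _.
  move=> j; apply: has_derive_eq (has_deriveX 2 (has_derive_coord j p v)) _.
  by rewrite /v mxE /=; ring.
by rewrite /sqr_norm mulr_sumr.
Qed.

Lemma has_derive_mono s m : has_derive (mono s m) p v
  (lam * (size s)%:R * mono s m p + tau * m%:R * mono s m.-1 p).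
Proof.
have Hs : has_derive (fun q : V => \prod_(j <- s) q.1 ord0 j) p v
    (lam * (size s)%:R * \prod_(j <- s) p.1 ord0 j).
  elim: s => [|j s IH].
    rewrite (_ : (fun _ => _) = fun _ => 1).
      by apply: has_derive_eq (has_derive_cst _ _ _) _; rewrite mulr0 mul0r.
    by apply/funext => q; rewrite big_nil.
  rewrite (_ : (fun _ => _) = fun q : V => q.1 ord0 j * \prod_(i <- s) q.1 ord0 i).
    apply: has_derive_eq (has_deriveM (has_derive_coord j p v) IH) _.
    by rewrite big_cons /v mxE /= [(size s).+1%:R]mulrS; ring.
  by apply/funext => q; rewrite big_cons.
apply: has_derive_eq (has_deriveM Hs (has_deriveX m (has_derive_time p v))) _.
by rewrite /mono /v /=; ring.
Qed.

Lemma has_derive_ground : has_derive ground p v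
  (- ground p * (lam * sqr_norm p.1 * (1 + p.2 ^+ 2) + tau * p.2 * sqr_norm p.1)).
Proof.
have H := has_deriveM (has_deriveM has_derive_sqr_norm
  (has_deriveD (has_derive_cst 1 p v) (has_deriveX 2 (has_derive_time p v))))
  (has_derive_cst (- 2^-1) p v).
rewrite (_ : ground = fun q => expR (sqr_norm q.1 * (1 + q.2 ^+ 2) * - 2^-1)).
  apply: has_derive_eq (has_derive_comp (is_derive_expR _) H) _.
  by rewrite /ground mulrN /v /=; field.
by apply/funext => q; rewrite /ground mulrN.
Qed.

Lemma has_derive_bump k : has_derive (bump 0 k) p v
  (- bump 2 k p * (2 * (lam * sqr_norm p.1 + tau * p.2) / k.+1%:R)).
Proof.
have H := has_deriveD (has_derive_cst 1 p v) (has_deriveM (has_deriveD has_derive_sqr_norm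
  (has_deriveX 2 (has_derive_time p v))) (has_derive_cst (- k.+1%:R^-1) p v)).
rewrite (_ : bump 0 k = fun q => flat 0 (1 + (sqr_norm q.1 + q.2 ^+ 2) * - k.+1%:R^-1)).
  apply: has_derive_eq (has_derive_comp (is_derive_flat _ _) H) _.
  by rewrite /bump mulrN /v /=; field; rewrite ?natr1 ?nat1r pnatr_eq0.
by apply/funext => q; rewrite /bump mulrN.
Qed.

Lemma has_derive_cutoff_test s m k : has_derive (cutoff_test s m k) p v (ground p *
  (bump 0 k p * (lam * (size s)%:R * mono s m p + tau * m%:R * mono s m.-1 p)
   - bump 2 k p * (2 * (lam * sqr_norm p.1 + tau * p.2) / k.+1%:R) * mono s m p
   - (lam * sqr_norm p.1 * (1 + p.2 ^+ 2) + tau * p.2 * sqr_norm p.1)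
     * bump 0 k p * mono s m p)).
Proof.
apply: has_derive_eq (has_deriveM (has_derive_bump k)
  (has_deriveM has_derive_ground (has_derive_mono s m))) _.
ring.
Qed.

End radial_derivatives.

Lemma d_t_cutoff_test s m k p : d_t (cutoff_test s m k) p = ground p *
  (bump 0 k p * (m%:R * mono s m.-1 p)
   - bump 2 k p * (2 * p.2 / k.+1%:R) * mono s m p
   - p.2 * sqr_norm p.1 * bump 0 k p * mono s m p).
Proof.
rewrite /d_t (_ : (0, 1) = (0 *: p.1, 1)); last by rewrite scale0r.
by rewrite (has_derive_cutoff_test p 0 1 s m k).2; ring.
Qed.

Lemma xi_dot_grad_cutoff_test s m k p : xi_dot_grad (cutoff_test s m k) p = ground p *
  (bump 0 k p * ((size s)%:R * mono s m p)
   - bump 2 k p * (2 * sqr_norm p.1 / k.+1%:R) * mono s m p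
   - sqr_norm p.1 * (1 + p.2 ^+ 2) * bump 0 k p * mono s m p).
Proof.
rewrite xi_dot_gradE; last exact: (has_derive_cutoff_test p 0 1 s m k).1.
rewrite (_ : (p.1, 0) = (1 *: p.1, 0)); last by rewrite scale1r.
by rewrite (has_derive_cutoff_test p 1 0 s m k).2; ring.
Qed.

(** Real and imaginary parts of (u + i w) / (t - i). *)
Definition quot_re (u w t : R) : R := (u * t - w) / (1 + t ^+ 2).
Definition quot_im (u w t : R) : R := (u + w * t) / (1 + t ^+ 2).

(** Multiplying the operator by t - i clears its denominator and leaves
    X + i Y with X and Y real; the factor 1 / (t - i) is moved to z. *)
Lemma mul_adjoint_op f p (z : R[i]) :
  let a := quot_re (complex.Re z) (complex.Im z) p.2 in
  let b := quot_im (complex.Re z) (complex.Im z) p.2 in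
  let X := - p.2 * d_t f p + xi_dot_grad f p + sqr_norm p.1 * f p in
  let Y := d_t f p + p.2 * sqr_norm p.1 * f p in
  z * adjoint_op f p = Complex (a * X - b * Y) (a * Y + b * X).
Proof.
move=> a b X Y; rewrite /a /b /X /Y.
have t0 : 1 + p.2 ^+ 2 != 0 by rewrite gt_eqF// ltr_pwDl// sqr_ge0.
have t1 : p.2 ^+ 2 + (-1) ^+ 2 != 0 by rewrite sqrrN expr1n addrC.
clear a b X Y; case: z => u w; rewrite /adjoint_op /quot_re /quot_im.
apply/eqP; rewrite eq_complex /=; apply/andP; split; apply/eqP; field.
all: exact: t0.
Qed.

Lemma mono_pred s m p : p.2 * (m%:R * mono s m.-1 p) = m%:R * mono s m p.
Proof. by case: m => [|m]; rewrite ?mul0r ?mulr0// /mono /= exprS; ring. Qed.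

(** The Gaussian absorbs the zeroth order terms of X and Y, so what remains is
    the action of xi . grad - t d_t and of d_t on the monomial (A and B) and on
    the bump (C and D, which carry the small factor 1 / (k + 1)). *)
Lemma mul_adjoint_cutoff_test s m k p (z : R[i]) :
  let a := quot_re (complex.Re z) (complex.Im z) p.2 in
  let b := quot_im (complex.Re z) (complex.Im z) p.2 in
  let A := ((size s)%:R - m%:R) * mono s m p in
  let B := m%:R * mono s m.-1 p in
  let C := 2 * (sqr_norm p.1 - p.2 ^+ 2) * mono s m p / k.+1%:R in
  let D := 2 * p.2 * mono s m p / k.+1%:R in
  z * adjoint_op (cutoff_test s m k) p = Complex
    (ground p * (bump 0 k p * (a * A - b * B) - bump 2 k p * (a * C - b * D)))
    (ground p * (bump 0 k p * (a * B + b * A) - bump 2 k p * (a * D + b * C))).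
Proof.
move=> a b A B C D; rewrite mul_adjoint_op -/a -/b.
have XE : - p.2 * d_t (cutoff_test s m k) p + xi_dot_grad (cutoff_test s m k) p
    + sqr_norm p.1 * cutoff_test s m k p = ground p * (bump 0 k p * A - bump 2 k p * C).
  rewrite d_t_cutoff_test xi_dot_grad_cutoff_test /cutoff_test /A mulrBl -mono_pred /C; ring.
have YE : d_t (cutoff_test s m k) p + p.2 * sqr_norm p.1 * cutoff_test s m k p
    = ground p * (bump 0 k p * B - bump 2 k p * D).
  by rewrite d_t_cutoff_test /cutoff_test /B /D; ring.
by rewrite XE YE; congr Complex; ring.
Qed.

Lemma smooth_sqr_norm : smooth (fun q : V => sqr_norm q.1).
Proof.
by apply: (@smooth_sum _ _ _ _ (fun j (q : V) => q.1 ord0 j ^+ 2)) => j;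
  apply: smoothX; exact: smooth_coord.
Qed.

Lemma smooth_cutoff_test s m k : smooth (cutoff_test s m k).
Proof.
have st2 : smooth (fun q : V => q.2 ^+ 2) by apply: smoothX; exact: smooth_time.
have s1 c : smooth (fun q : V => c : R) by exact: smooth_cst.
apply: smoothM; last apply: smoothM.
- rewrite /bump; apply: (@smooth_comp _ _ (flat 0)); first exact: smooth_flat.
  rewrite (_ : (fun _ => _) = fun q : V => 1 + (sqr_norm q.1 + q.2 ^+ 2) * - k.+1%:R^-1).
    apply: smoothD => //; apply: smoothM => //; apply: smoothD => //.
    exact: smooth_sqr_norm.
  by apply/funext => q; rewrite mulrN.
- rewrite /ground; apply: (@smooth_comp _ _ expR); first exact: smooth_expR.
  rewrite (_ : (fun _ => _) = fun q : V => sqr_norm q.1 * (1 + q.2 ^+ 2) * - 2^-1).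
    apply: smoothM => //; apply: smoothM; first exact: smooth_sqr_norm.
    exact: smoothD.
  by apply/funext => q; rewrite mulrN.
- apply: smoothM; last by apply: smoothX; exact: smooth_time.
  apply: (@smooth_prod _ _ _ _ (fun j (q : V) => q.1 ord0 j)) => j.
  exact: smooth_coord.
Qed.

Lemma sqr_norm_ge0 (x : 'rV[R]_n) : 0 <= sqr_norm x.
Proof. by apply: sumr_ge0 => j _; exact: sqr_ge0. Qed.

Lemma coord_le_sqr_norm (x : 'rV[R]_n) j : x ord0 j ^+ 2 <= sqr_norm x.
Proof.
rewrite /sqr_norm (bigD1 j)//= lerDl; apply: sumr_ge0 => i _; exact: sqr_ge0.
Qed.

Lemma test_function_cutoff_test s m k : test_function (cutoff_test s m k).
Proof.
split; first exact: smooth_cutoff_test.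
pose K : set V := [set x : 'rV[R]_n | forall j : 'I_n, `[- k.+1%:R, k.+1%:R]%classic (x ord0 j)]
  `*` `[- k.+1%:R, k.+1%:R]%classic.
have cK : compact K.
  apply: compact_setX; last exact: segment_compact.
  apply: (@rV_compact R n (fun _ => `[- k.+1%:R, k.+1%:R]%classic)) => j.
  exact: segment_compact.
have clK : closed K.
  exact: (compact_closed (@norm_hausdorff R V) cK).
apply: (subclosed_compact _ cK); first exact: closed_closure.
rewrite [X in _ `<=` X](closure_id K).1//; apply: closure_subset => p /=.
(* The bump vanishes once |xi|^2 + t^2 >= k + 1, and |y| <= k + 1 follows from y^2 <= k + 1. *)
have [Q|Q _] := leP (k.+1%:R) (sqr_norm p.1 + p.2 ^+ 2).
  rewrite /cutoff_test /bump /flat ltNge subr_le0 ler_pdivlMr ?ltr0n// mul1r Q /=.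
  by rewrite mul0r eqxx.
have k1 : 1 <= k.+1%:R :> R by rewrite ler1n.
have bnd (y : R) : y ^+ 2 <= k.+1%:R -> `[- k.+1%:R, k.+1%:R]%classic y.
  move=> yk; rewrite /= in_itv /= -ler_norml.
  have := sqr_ge0 (`|y| - 1); rewrite -real_normK ?num_real// in yk *.
  by nra.
split=> [j|]; apply: bnd.
  have := coord_le_sqr_norm p.1 j; have := sqr_ge0 p.2; lra.
by have := sqr_norm_ge0 p.1; lra.
Qed.

End test_functions.

(** * Null sets and completed measurability *)

Section null_sets.
Import HBSimple HBNNSimple.
Context d (T : measurableType d) (R : realType).
Variable mu : {measure set T -> \bar R}.

(** True for arbitrary f and g: the integral is the supremum of the integrals of
    the simple functions below, and multiplying a simple function by the
    indicator of the complement of N preserves its integral. *)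
Lemma ge0_le_integral_null (N : set T) (f g : T -> \bar R) :
  measurable N -> mu N = 0%E ->
  (forall x, (0 <= f x)%E) -> (forall x, (0 <= g x)%E) ->
  (forall x, ~ N x -> (f x <= g x)%E) ->
  (\int[mu]_x f x <= \int[mu]_x g x)%E.
Proof.
move=> mN N0 f0 g0 fg; rewrite !ge0_integralTE//.
apply: ub_ereal_sup => _ /= [h hf <-].
pose h' := proj_nnsfun h (measurableC mN).
rewrite (_ : sintegral mu (h : T -> R) = sintegral mu (h' : T -> R)).
  apply: ereal_sup_ubound; exists h' => // x.
  have [Nx|Nx] := pselect (N x).
    by rewrite /h' /= mindicE [_ \in _]memNset ?mulr0//; apply.
  by rewrite /h' /= mindicE [_ \in _]mem_set ?mulr1//; apply: le_trans (hf x) (fg _ Nx).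
rewrite -!integralT_nnsfun; apply: ge0_ae_eq_integral => //.
- exact/measurable_EFinP.
- exact/measurable_EFinP.
- by move=> x _; rewrite lee_fin.
- by move=> x _; rewrite lee_fin.
exists N; split => // x /=; apply: contra_notP => Nx _.
by rewrite /h' /= mindicE [_ \in _]mem_set ?mulr1.
Qed.

Lemma ge0_eq_integral_null (N : set T) (f g : T -> \bar R) :
  measurable N -> mu N = 0%E ->
  (forall x, (0 <= f x)%E) -> (forall x, (0 <= g x)%E) ->
  (forall x, ~ N x -> f x = g x) ->
  (\int[mu]_x f x = \int[mu]_x g x)%E.
Proof.
move=> mN N0 f0 g0 fg; apply/eqP; rewrite eq_le.
by rewrite !(@ge0_le_integral_null N)// => x Nx; rewrite fg.
Qed.

Lemma eq_Rintegral_null (N : set T) (f g : T -> R) :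
  measurable N -> mu N = 0%E -> (forall x, ~ N x -> f x = g x) ->
  \int[mu]_x f x = \int[mu]_x g x.
Proof.
move=> mN N0 fg; rewrite /Rintegral [in LHS]integralE [in RHS]integralE.
by congr (fine (_ - _)%E); apply: (@ge0_eq_integral_null N) => // x Nx;
  rewrite ?funeposE ?funenegE fg.
Qed.

(** For each rational q the set {f > q} is Borel up to a null set; N is the
    union of these countably many null sets. *)
Lemma completed_measurable_restrict (f : T -> R) :
  completed_measurable_fun mu f ->
  exists2 N, measurable N /\ mu N = 0%E & measurable_fun (~` N) f.
Proof.
move=> mf.
have /choice[AN HAN] : forall q : rat, exists AN : set T * set T,
    [/\ measurable AN.1, measurable AN.2, mu AN.2 = 0%E &
     forall x, ~ AN.2 x -> (ratr q < f x) = (x \in AN.1) ].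
  move=> q; have [A mA [M [N [mN N0 MN]] fE]] := mf `]ratr q, +oo[%classic (measurable_itv _).
  exists (A, N); split => //= x Nx; apply/idP/idP => [qx|/set_mem Ax].
    have : (f @^-1` `]ratr q, +oo[%classic) x by rewrite /= in_itv/= qx.
    by rewrite -fE => -[Ax|/MN//]; exact: mem_set.
  have : (f @^-1` `]ratr q, +oo[%classic) x by rewrite -fE; left.
  by rewrite /= in_itv/= andbT.
pose rk k : rat := odflt 0 (unpickle k).
pose N := \bigcup_k (AN (rk k)).2.
have mN : measurable N by apply: bigcupT_measurable => k; have [] := HAN (rk k).
have ANN q y : (AN q).2 y -> N y.
  by move=> ANy; exists (pickle q) => //; rewrite /rk pickleK.
exists N.
  split=> //; apply/negligibleP => //; apply: negligible_bigcup => k.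
  by apply/negligibleP; have [] := HAN (rk k).
move=> mNC.
apply: (measurability _ (RGenOInfty.measurableE R)) => // _ [_ [x ->] <-].
rewrite (_ : _ `&` _ = \bigcup_q
    (if x < ratr q then ~` N `&` (AN q).1 else set0)).
  apply: bigcupT_measurable_rat => q; case: ifP => // _.
  by apply: measurableI => //; have [] := HAN q.
apply/seteqP; split => [y [Ny]|y [q _]].
  rewrite /= in_itv/= andbT => xy; have [q] := rat_in_itvoo xy; rewrite in_itv /= => /andP[xq qy].
  exists q => //; rewrite xq; split => //; apply: set_mem.
  have [_ _ _ <-//] := HAN q; by move/ANN.
case: ifPn => // xq [Ny Aqy]; split=> //; rewrite /= in_itv /= andbT.
apply: lt_trans xq _; have [_ _ _ ->] := HAN q; first exact: mem_set.
by move/ANN.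
Qed.
End null_sets.

(** * Gaussian integrals *)

Section gaussian_integrability.
Variable R : realType.
Local Notation leb := (@lebesgue_measure R).

Lemma integral_oneDsqrV_fin : (\int[leb]_x ((1 + x ^+ 2)^-1)%:E < +oo)%E.
Proof.
have := @ge0_symfun_integralT R (fun x => (1 + x ^+ 2)^-1).
move=> -> //; last first.
- by move=> x /=; rewrite sqrrN.
- exact: continuous_oneDsqrV.
- by move=> x; rewrite invr_ge0 addr_ge0// sqr_ge0.
rewrite (_ : [set x | _] = `[0, +oo[%classic); last first.
  by apply/seteqP; split => x/=; rewrite in_itv/= andbT.
by rewrite (integral0y_oneDsqr R) -EFinM ltry.
Qed.

Lemma measurable_oneDsqrV : measurable_fun [set: R] (fun x : R => (1 + x ^+ 2)^-1).
Proof. by apply: continuous_measurable_fun; exact: continuous_oneDsqrV. Qed.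

Lemma expRN_le_inv (y : R) : 0 <= y -> expR (- y) <= (1 + y)^-1.
Proof.
move=> y0; rewrite expRN lef_pV2 ?posrE ?expR_gt0//; first exact: expR_ge1Dx.
by rewrite ltr_pwDl.
Qed.

(** Comparison with 1 / (1 + x^2), since e^(-y) <= 1 / (1 + y). *)
Lemma integral_gauss_fin : (\int[leb]_x (expR (- (x ^+ 2 / 4)))%:E < +oo)%E.
Proof.
apply: le_lt_trans (_ : \int[leb]_x (4%:E * ((1 + x ^+ 2)^-1)%:E) < +oo)%E.
  apply: ge0_le_integral => //.
  - apply/measurable_EFinP; apply: measurableT_comp => //.
    apply: measurableT_comp => //; apply: measurable_funM => //.
  - by apply/measurable_EFinP; apply: measurable_funM => //; exact: measurable_oneDsqrV.
  - move=> x _; rewrite -EFinM lee_fin.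
    have x2 := sqr_ge0 x.
    apply: le_trans (expRN_le_inv _) _; first by rewrite divr_ge0.
    have -> : 4 / (1 + x ^+ 2) = ((1 + x ^+ 2) / 4)^-1 by rewrite invf_div.
    by rewrite lef_pV2 ?posrE; lra.
rewrite ge0_integralZl//.
- by rewrite lte_mul_pinfty// integral_oneDsqrV_fin.
- by apply/measurable_EFinP; exact: measurable_oneDsqrV.
- by move=> x _; rewrite lee_fin invr_ge0 addr_ge0// sqr_ge0.
Qed.

Lemma measurable_sqr_norm n : measurable_fun [set: 'rV[R]_n] (@sqr_norm R n).
Proof.
apply: (@measurable_sum _ _ _ _ _ _ (fun j (x : 'rV[R]_n) => x ord0 j ^+ 2)) => j.
by apply: measurable_funX; exact: (@measurable_rV_coor R n j).
Qed.

Lemma sqr_norm_cons n (x : R) (v : 'rV[R]_n) :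
  sqr_norm (rV_cons (x, v)) = x ^+ 2 + sqr_norm v.
Proof.
rewrite /sqr_norm big_ord_recl rV_cons0; congr (_ + _).
by apply: eq_bigr => j _; rewrite rV_consS.
Qed.

(** Tonelli for the recursive construction of the measure. *)
Lemma ge0_integral_lebesgue_rVS n (f : 'rV[R]_n.+1 -> \bar R) :
  measurable_fun setT f -> (forall x, (0 <= f x)%E) ->
  (\int[lebesgue_rV R n.+1]_x f x =
   \int[lebesgue_rV R n]_v \int[leb]_x f (rV_cons (x, v)))%E.
Proof.
move=> mf f0.
have mc : measurable_fun [set: (measurableTypeR R * 'rV[R]_n)%type] (@rV_cons R n).
  exact: measurable_rV_cons.
have := (@ge0_integral_pushforward _ _ (measurableTypeR R * 'rV[R]_n)%type _ _ _ mc
  (leb \x lebesgue_rV R n)%E _ f measurableT mf).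
rewrite preimage_setT => ->; last by move=> x _; exact: f0.
apply: (@fubini_tonelli2 _ _ (measurableTypeR R) 'rV[R]_n R leb (lebesgue_rV R n)
  (f \o @rV_cons R n)).
- exact: measurableT_comp.
- by move=> p; exact: f0.
Qed.

Lemma integral_gauss_rV_fin n :
  (\int[lebesgue_rV R n]_x (expR (- (sqr_norm x / 4)))%:E < +oo)%E.
Proof.
have mg k : measurable_fun [set: 'rV[R]_k] (fun x => (expR (- (sqr_norm x / 4)))%:E).
  apply/measurable_EFinP; apply: measurableT_comp => //.
  apply: measurableT_comp => //; apply: measurable_funM => //.
  exact: measurable_sqr_norm.
have g0 k (x : 'rV[R]_k) : (0 <= (expR (- (sqr_norm x / 4)))%:E)%E.
  by rewrite lee_fin expR_ge0.
elim: n => [|n IH].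
  rewrite integral_dirac//; last exact: mg.
  match goal with |- is_true (Order.lt (mule ?a ?b) ?c) => have -> : a = 1%E by exact: diracT end.
  by rewrite mul1e ltry.
rewrite ge0_integral_lebesgue_rVS//.
rewrite (_ : (fun v => _) = fun v : 'rV[R]_n => ((expR (- (sqr_norm v / 4)))%:E *
    \int[leb]_x (expR (- (x ^+ 2 / 4)))%:E)%E); last first.
  apply/funext => v; rewrite -ge0_integralZl//.
    apply: eq_integral => x _; rewrite -EFinM -expRD sqr_norm_cons.
    by congr (expR _)%:E; lra.
  apply/measurable_EFinP; apply: measurableT_comp => //.
  by apply: measurableT_comp => //; apply: measurable_funM.
have I0 : (0 <= \int[lebesgue_rV R n]_v (expR (- (sqr_norm v / 4)))%:E)%E.
  by apply: integral_ge0 => v _; exact: g0.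
have J0 : (0 <= \int[leb]_x (expR (- (x ^+ 2 / 4)))%:E)%E.
  by apply: integral_ge0 => x _; rewrite lee_fin expR_ge0.
rewrite ge0_integralZr//.
by apply: lte_mul_pinfty; [exact: I0|rewrite ge0_fin_numE|exact: integral_gauss_fin].
exact: mg.
Qed.

End gaussian_integrability.

(** * Square integrability of the slices *)

Section slices.
Variables (R : realType) (n : nat).
Local Notation leb := (@lebesgue_measure R).
Local Notation mu := (lebesgue_spacetime R n).
Local Notation V := ('rV[R]_n * measurableTypeR R)%type.

(** Tonelli applied to the indicator of N. *)
Lemma null_slices (N : set V) : measurable N -> mu N = 0%E ->
  exists2 M : set R, measurable M /\ leb M = 0%E &
    forall t, ~ M t -> measurable [set xi | N (xi, t)] /\
      lebesgue_rV R n [set xi | N (xi, t)] = 0%E.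
Proof.
move=> mN N0.
have yE t : ysection N t = [set xi | N (xi, t)].
  by apply/seteqP; split => xi /=; [rewrite ysectionE|rewrite ysectionE].
have mF : measurable_fun [set: measurableTypeR R] (lebesgue_rV R n \o ysection N).
  exact: measurable_fun_ysection.
have F0 (t : measurableTypeR R) : (0 <= (lebesgue_rV R n \o ysection N) t)%E by [].
have I0 : (\int[leb]_t `|(lebesgue_rV R n \o ysection N) t| = 0)%E.
  under eq_integral do rewrite gee0_abs//.
  rewrite -indic_fubini_tonelli_GE//.
  have := @indic_fubini_tonelli1 _ _ 'rV[R]_n (measurableTypeR R) R (lebesgue_rV R n) leb N mN.
  have := @indic_fubini_tonelli _ _ 'rV[R]_n (measurableTypeR R) R (lebesgue_rV R n) leb N mN.
  move=> <- <-.
  by rewrite integral_indic// setIT; exact: N0.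
have /(ae_eq_integral_abs _ measurableT mF)[M [mM M0 MN]] := I0.
exists M => // t Mt; rewrite -yE; split; first exact: measurable_ysection.
by apply: contrapT => Nt; apply/Mt/MN => /= H; exact/Nt/H.
Qed.

Lemma integral_le_sqr_cL2norm (f : 'rV[R]_n -> R[i]) (c : R) : 0 <= c ->
  (cL2norm (lebesgue_rV R n) f <= c%:E)%E ->
  (\int[lebesgue_rV R n]_x (complex.Re (f x) ^+ 2 + complex.Im (f x) ^+ 2)%:E
    <= (c ^+ 2)%:E)%E.
Proof.
move=> c0 fc.
have two0 : (2 : R) != 0 by rewrite pnatr_eq0.
have E := poweR_Lnorm (lebesgue_rV R n)
  (fun x => (ComplexField.Normc.normc (f x))%:E) two0.
have : (cL2norm (lebesgue_rV R n) f `^ 2 <= c%:E `^ 2)%E.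
  apply: gt0_ler_poweR => //; rewrite in_itv /= ?leey ?andbT ?lee_fin //.
  exact: Lnorm_ge0.
rewrite /cL2norm E poweR_EFin powR_mulrn//.
apply: le_trans; rewrite le_eqVlt; apply/orP; left; apply/eqP.
apply: eq_integral => x _; rewrite /= powR_mulrn//; congr EFin.
case: (f x) => a b /=; rewrite real_normK ?num_real// sqr_sqrtr//.
by rewrite addr_ge0// sqr_ge0.
Qed.

End slices.

(** * An integrable majorant in spacetime *)

Section spacetime_integrability.
Variables (R : realType) (n : nat).
Local Notation leb := (@lebesgue_measure R).
Local Notation mu := (lebesgue_spacetime R n).
Local Notation V := ('rV[R]_n * measurableTypeR R)%type.

Lemma measurable_space_coord (j : 'I_n) :
  measurable_fun [set: V] (fun p : V => p.1 ord0 j : R).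
Proof.
exact: (measurableT_comp (@measurable_rV_coor R n j) measurable_fst).
Qed.

Lemma measurable_time : measurable_fun [set: V] (fun p : V => p.2 : R).
Proof. exact: measurable_snd. Qed.

Lemma measurable_spacetime_sqr_norm :
  measurable_fun [set: V] (fun p : V => sqr_norm p.1).
Proof. exact: (measurableT_comp (@measurable_sqr_norm R n) measurable_fst). Qed.

Lemma measurable_oneDtime :
  measurable_fun [set: V] (fun p : V => 1 + (p.2 : R) ^+ 2).
Proof.
by apply: measurable_funD => //; apply: measurable_funX; exact: measurable_time.
Qed.

Lemma measurable_oneDtimeV :
  measurable_fun [set: V] (fun p : V => (1 + (p.2 : R) ^+ 2)^-1).
Proof. exact: (measurableT_comp (@measurable_oneDsqrV R) measurable_time). Qed.

(** The exponent n + 1 compensates the growth (1 + t^2)^n of the integrals of the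
    slices of q and leaves the integrable function 1 / (1 + t^2). *)
Definition envelope (q : V -> R) (p : V) : R :=
  (q p + expR (- (sqr_norm p.1 / 4))) * ((1 + p.2 ^+ 2)^-1) ^+ n.+1.

Lemma measurable_envelope (q : V -> R) : measurable_fun setT q ->
  measurable_fun setT (envelope q).
Proof.
move=> mq; apply: measurable_funM.
  apply: measurable_funD => //; apply: measurableT_comp => //.
  apply: measurableT_comp => //; apply: measurable_funM => //.
  exact: measurable_spacetime_sqr_norm.
by apply: measurable_funX; exact: measurable_oneDtimeV.
Qed.

Lemma envelope_ge0 (q : V -> R) p : (forall p, 0 <= q p) -> 0 <= envelope q p.
Proof.
move=> q0; rewrite mulr_ge0// ?addr_ge0 ?expR_ge0// exprn_ge0// invr_ge0.
by rewrite addr_ge0// sqr_ge0.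
Qed.

(** Integrate in xi first; the slices over the null set M are discarded. *)
Lemma integrable_envelope (q : V -> R) (C : R) (M : set R) :
  measurable_fun setT q -> (forall p, 0 <= q p) ->
  measurable M -> leb M = 0%E -> 0 <= C ->
  (forall t, ~ M t -> (\int[lebesgue_rV R n]_xi (q (xi, t))%:E <=
     (C * (1 + t ^+ 2) ^+ n)%:E)%E) ->
  mu.-integrable setT (EFin \o envelope q).
Proof.
move=> mq q0 mM M0 C0 qC.
have mW := measurable_envelope mq.
have W0 p : 0 <= envelope q p by exact: envelope_ge0.
apply/integrableP; split; first exact/measurable_EFinP.
under eq_integral do rewrite gee0_abs ?lee_fin//.
pose G := fine (\int[lebesgue_rV R n]_x (expR (- (sqr_norm x / 4)))%:E)%E.
have GE : (\int[lebesgue_rV R n]_x (expR (- (sqr_norm x / 4)))%:E = G%:E)%E.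
  rewrite fineK// ge0_fin_numE; first exact: integral_gauss_rV_fin.
  by apply: integral_ge0 => x _; rewrite lee_fin expR_ge0.
have G0 : 0 <= G.
  by apply: fine_ge0; apply: integral_ge0 => x _; rewrite lee_fin expR_ge0.
rewrite (@fubini_tonelli2 _ _ 'rV[R]_n (measurableTypeR R) R (lebesgue_rV R n) leb)//;
  last exact/measurable_EFinP.
apply: (@le_lt_trans _ _ (\int[leb]_t ((C + G)%:E * ((1 + t ^+ 2)^-1)%:E))%E); last first.
  rewrite ge0_integralZl//; last 3 first.
  - by apply/measurable_EFinP; exact: measurable_oneDsqrV.
  - by move=> x _; rewrite lee_fin invr_ge0 addr_ge0// sqr_ge0.
  - by rewrite lee_fin addr_ge0.
  apply: lte_mul_pinfty; rewrite ?lee_fin ?addr_ge0//.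
  exact: integral_oneDsqrV_fin.
apply: (@ge0_le_integral_null _ (measurableTypeR R) _ _ M) => //.
- by move=> t; apply: integral_ge0 => x _; rewrite lee_fin.
- by move=> t; rewrite -EFinM lee_fin mulr_ge0 ?addr_ge0// invr_ge0 addr_ge0// sqr_ge0.
move=> t Mt; rewrite /fubini_G /envelope /=.
set T := 1 + t ^+ 2; have T1 : 1 <= T by rewrite /T lerDl sqr_ge0.
have T0 : 0 < T by exact: lt_le_trans T1.
have mqt : measurable_fun setT (fun x : 'rV[R]_n => (q (x, t))%:E).
  by apply/measurable_EFinP; exact: (measurableT_comp mq (@pair2_measurable _ _ _ _ t)).
have mgt : measurable_fun setT (fun x : 'rV[R]_n => (expR (- (sqr_norm x / 4)))%:E).
  apply/measurable_EFinP; apply: measurableT_comp => //.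
  apply: measurableT_comp => //; apply: measurable_funM => //.
  exact: measurable_sqr_norm.
under eq_integral do rewrite EFinM EFinD.
rewrite ge0_integralZr//; last 3 first.
- exact: emeasurable_funD.
- by move=> x _; rewrite adde_ge0// lee_fin// expR_ge0.
- by rewrite lee_fin exprn_ge0// invr_ge0 ltW.
rewrite ge0_integralD//; last by move=> x _; rewrite lee_fin ?expR_ge0.
rewrite GE.
apply: (@le_trans _ _ (((C * T ^+ n)%:E + G%:E) * (T^-1 ^+ n.+1)%:E)%E).
  apply: lee_wpmul2r; first by rewrite lee_fin exprn_ge0// invr_ge0 ltW.
  by apply: leeD => //; exact: qC.
rewrite -EFinD -!EFinM lee_fin exprS mulrCA mulrC.
rewrite ler_wpM2r ?invr_ge0 ?(ltW T0)// mulrDl lerD//.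
  by rewrite -mulrA -exprMn mulfV ?gt_eqF// expr1n mulr1.
by rewrite ler_piMr// exprn_ile1 ?invr_ge0 ?(ltW T0)// invf_le1.
Qed.

End spacetime_integrability.

(** * Functions annihilated by a family of weights *)

Section real_integrals.
Context d (T : measurableType d) (R : realType).
Variable mu : {measure set T -> \bar R}.
Implicit Types (f g h : T -> R).

Definition rintegrable f := mu.-integrable setT (EFin \o f).

Lemma rintegrable_measurable f : rintegrable f -> measurable_fun setT f.
Proof. by move=> /integrableP[/measurable_EFinP]. Qed.

Lemma rintegrable_le f g : measurable_fun setT f ->
  (forall x, `|f x| <= g x) -> rintegrable g -> rintegrable f.
Proof.
move=> mf fg; apply: le_integrable => //; first exact/measurable_EFinP.
by move=> x _ /=; rewrite lee_fin; apply: le_trans (fg x) (ler_norm _).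
Qed.

Lemma rintegrable_norm f : rintegrable f -> rintegrable (fun x => `|f x|).
Proof.
move=> fi; have mf := rintegrable_measurable fi; apply: le_integrable fi => //.
  by apply/measurable_EFinP; exact: measurableT_comp.
by move=> x _ /=; rewrite normr_id.
Qed.

Lemma rintegrableZ c f : rintegrable f -> rintegrable (fun x => c * f x).
Proof.
move=> fi; rewrite /rintegrable (_ : _ \o _ = fun x => (c%:E * (EFin \o f) x)%E).
  exact: integrableZl.
by apply/funext => x /=; rewrite EFinM.
Qed.

Lemma rintegrableD f g : rintegrable f -> rintegrable g ->
  rintegrable (fun x => f x + g x).
Proof.
move=> fi gi; rewrite /rintegrable.
rewrite (_ : _ \o _ = fun x => ((EFin \o f) x + (EFin \o g) x)%E).
  exact: integrableD.
by apply/funext => x /=; rewrite EFinD.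
Qed.

(** Dominated convergence for real-valued functions and real integrals. *)
Lemma rintegral_dominated (F : nat -> T -> R) f g :
  (forall k, measurable_fun setT (F k)) ->
  (forall x, F k x @[k --> \oo] --> f x) ->
  rintegrable g -> (forall k x, `|F k x| <= g x) ->
  [/\ measurable_fun setT f, rintegrable f &
    \int[mu]_x F k x @[k --> \oo] --> \int[mu]_x f x].
Proof.
move=> mF Ff gi Fg.
have mf : measurable_fun setT f.
  by apply: (measurable_fun_cvg mF) => x _; exact: Ff.
have := @dominated_convergence _ _ _ mu setT measurableT
  (fun k => EFin \o F k) (EFin \o f) (EFin \o g).
case.
- by move=> k; exact/measurable_EFinP.
- exact/measurable_EFinP.
- by apply: nearW => x _; apply: cvg_EFin; [exact: nearW|exact: Ff].
- exact: gi.
- by apply: nearW => x k _; rewrite /= lee_fin.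
move=> fi _.
have <- : ((\int[mu]_x f x)%:E = \int[mu]_(x in setT) (EFin \o f) x)%E.
  by rewrite fineK//; exact: integrable_fin_num.
by move=> /fine_cvgP[_ cv]; split.
Qed.

End real_integrals.

Section annihilators.
Context d (T : measurableType d) (R : realType).
Variable mu : {measure set T -> \bar R}.
Variable G : set (T -> R).
Implicit Types (f h l psi : T -> R).

(** Below, G consists of the products of a fixed weight with all admissible
    monomials; being annihilated is then a property stable under
    multiplication by the variables of these monomials. *)
Definition annihilated f := measurable_fun setT f /\ forall h, G h ->
  rintegrable mu (fun x => h x * f x) /\ \int[mu]_x (h x * f x) = 0.

Definition multiplier l := forall f, annihilated f -> annihilated (fun x => l x * f x).

Lemma eq_annihilated f f' : f =1 f' -> annihilated f -> annihilated f'.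
Proof. by move=> /funext ->. Qed.

Lemma annihilatedD f f' : annihilated f -> annihilated f' -> annihilated (fun x => f x + f' x).
Proof.
move=> [mf If] [mf' If']; split=> [|h Gh]; first exact: measurable_funD.
have [i1 z1] := If h Gh; have [i2 z2] := If' h Gh.
rewrite (_ : (fun x => _) = fun x => h x * f x + h x * f' x); last first.
  by apply/funext => x; rewrite mulrDr.
by split; [exact: rintegrableD|rewrite RintegralD// z1 z2 addr0].
Qed.

Lemma annihilatedZ c f : annihilated f -> annihilated (fun x => c * f x).
Proof.
move=> [mf If]; split=> [|h Gh]; first exact: measurable_funM.
have [i1 z1] := If h Gh.
rewrite (_ : (fun x => _) = fun x => c * (h x * f x)); last first.
  by apply/funext => x; rewrite mulrCA.
by split; [exact: rintegrableZ|rewrite RintegralZl// z1 mulr0].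
Qed.

Lemma annihilated0 : annihilated (fun _ => 0).
Proof.
split=> [|h Gh]; first exact: measurable_cst.
rewrite (_ : (fun x => _) = fun x => 0); last by apply/funext => x; rewrite mulr0.
split; last by rewrite Rintegral_cst// mul0r.
rewrite /rintegrable (_ : _ \o _ = cst 0%E)//; exact: integrable0.
Qed.

Lemma annihilated_sum N (F : nat -> T -> R) : (forall k, annihilated (F k)) ->
  annihilated (fun x => \sum_(0 <= k < N) F k x).
Proof.
move=> Fann; elim: N => [|N IH].
  by apply: eq_annihilated annihilated0 => x; rewrite big_geq.
by apply: eq_annihilated (annihilatedD IH (Fann N)) => x; rewrite big_nat_recr.
Qed.

Lemma annihilated_lim (F : nat -> T -> R) f D :
  (forall k, annihilated (F k)) -> (forall k x, `|F k x| <= D x) ->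
  (forall x, F k x @[k --> \oo] --> f x) ->
  (forall h, G h -> measurable_fun setT h /\ rintegrable mu (fun x => `|h x| * D x)) ->
  annihilated f.
Proof.
move=> Fann FD Ff hD.
have mf : measurable_fun setT f.
  by apply: (@measurable_fun_cvg _ _ _ _ F) => [k|x _]; [case: (Fann k)|exact: Ff].
split=> // h Gh; have [mh hDi] := hD h Gh.
have [] := @rintegral_dominated _ _ _ mu (fun k x => h x * F k x)
  (fun x => h x * f x) (fun x => `|h x| * D x) _ _ hDi.
- by move=> k; apply: measurable_funM => //; case: (Fann k).
- by move=> x; apply: cvgM; [exact: cvg_cst|exact: Ff].
- by move=> k x; rewrite normrM ler_wpM2l.
move=> _ fi cv; split=> //.
apply: (cvg_unique _ cv) => //.
rewrite (_ : (fun k => _) = fun _ => 0); first exact: cvg_cst.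
by apply/funext => k; have [_ /(_ h Gh)[]] := Fann k.
Qed.

Lemma multiplier_cst c : multiplier (fun _ => c).
Proof. by move=> f; exact: annihilatedZ. Qed.

Lemma multiplierD l l' : multiplier l -> multiplier l' ->
  multiplier (fun x => l x + l' x).
Proof.
move=> ml ml' f fann; apply: eq_annihilated (annihilatedD (ml f fann) (ml' f fann)) => x.
by rewrite mulrDl.
Qed.

Lemma multiplierM l l' : multiplier l -> multiplier l' ->
  multiplier (fun x => l x * l' x).
Proof.
by move=> ml ml' f fann; apply: eq_annihilated (ml _ (ml' _ fann)) => x; rewrite mulrA.
Qed.

Lemma multiplierX l m : multiplier l -> multiplier (fun x => l x ^+ m).
Proof.
move=> ml; elim: m => [|m IH]; first exact: multiplier_cst.
by rewrite (_ : (fun x => _) = fun x => l x * l x ^+ m);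
  [exact: multiplierM|apply/funext => x; rewrite exprS].
Qed.

Lemma multiplier_stable l : measurable_fun setT l ->
  (forall h, G h -> G (fun x => h x * l x)) -> multiplier l.
Proof.
move=> ml Gl f [mf If]; split=> [|h Gh]; first exact: measurable_funM.
have := If _ (Gl h Gh).
by rewrite (_ : (fun x => h x * (l x * f x)) = fun x => h x * l x * f x);
  [|apply/funext => x; rewrite mulrA].
Qed.

End annihilators.

(** * Approximation of the sign by polynomials of the sine *)

Section sign_iteration.
Variable R : realType.
Implicit Types (x s : R).

Lemma norm_series_sin_coeff_le x N :
  `|series (sin_coeff x) N| <= expR `|x|.
Proof.
apply: le_trans (ler_norm_sum _ _ _) _.
apply: (@le_trans _ _ (series (exp_coeff `|x|) N)).
  apply: ler_sum => k _; rewrite /sin_coeff /exp_coeff /= normrM normfV.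
  rewrite [`|k`!%:R|]ger0_norm// ler_wpM2r ?invr_ge0// normrM normrX.
  rewrite ler_piMl ?exprn_ge0// normrM normrX normrN1 expr1n mulr1.
  by case: (odd k); rewrite ?normr1 ?normr0.
rewrite /expR; apply: nondecreasing_cvgn_le; last exact: is_cvg_series_exp_coeff.
by apply: nondecreasing_series => k _ _; rewrite /exp_coeff /= divr_ge0// exprn_ge0.
Qed.

Lemma cvg_series_sin_coeff x : series (sin_coeff x) N @[N --> \oo] --> sin x.
Proof. by rewrite sin.unlock; exact: is_cvg_series_sin_coeff. Qed.

(** It fixes -1, 0 and 1, and its iterates on [-1, 1] tend to the sign. *)
Definition cubic s : R := (3 * s - s ^+ 3) / 2.

Lemma cubic_norm s : `|s| <= 1 -> `|cubic s| <= 1.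
Proof.
rewrite !ler_norml => /andP[s1 s2].
apply/andP; split; rewrite -subr_ge0.
  have -> : cubic s - -1 = (1 + s) ^+ 2 * (2 - s) / 2 by rewrite /cubic; field.
  by rewrite divr_ge0// mulr_ge0 ?sqr_ge0//; lra.
have -> : 1 - cubic s = (1 - s) ^+ 2 * (2 + s) / 2 by rewrite /cubic; field.
by rewrite divr_ge0// mulr_ge0 ?sqr_ge0//; lra.
Qed.

Lemma cubic_iter_norm s k : `|s| <= 1 -> `|iter k cubic s| <= 1.
Proof. by move=> s1; elim: k => //= k; exact: cubic_norm. Qed.

Lemma cubicN s : cubic (- s) = - cubic s.
Proof. by rewrite /cubic; field. Qed.

Lemma cubic_iterN s k : iter k cubic (- s) = - iter k cubic s.
Proof. by elim: k => //= k ->; rewrite cubicN. Qed.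

(** The iterates never fall below s, so each step multiplies their distance to 1
    by at most 1 - s / 2. *)
Lemma cubic_iter_pos s k : 0 < s <= 1 ->
  s <= iter k cubic s <= 1 /\ 1 - iter k cubic s <= (1 - s / 2) ^+ k.
Proof.
move=> /andP[s0 s1]; elim: k => [|k [/andP[a b] c]] /=.
  by rewrite lexx s1 expr0; split=> //; lra.
set y := iter k cubic s in a b c *.
have y0 : 0 < y by exact: lt_le_trans a.
split.
  apply/andP; split; last first.
    by apply: le_trans (ler_norm _) _; apply: cubic_norm; rewrite ger0_norm// ltW.
  apply: le_trans a _; rewrite -subr_ge0.
  have -> : cubic y - y = y * (1 + y) * (1 - y) / 2 by rewrite /cubic; field.
  by rewrite divr_ge0// !mulr_ge0//; lra.
have -> : 1 - cubic y = (1 - (y + y ^+ 2) / 2) * (1 - y).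
  by rewrite /cubic; field.
rewrite [leRHS]exprS; apply: ler_pM => //; nra.
Qed.

Lemma cvg_cubic_iter s : `|s| <= 1 -> iter k cubic s @[k --> \oo] --> Num.sg s.
Proof.
have pos r : 0 < r <= 1 -> iter k cubic r @[k --> \oo] --> (1 : R).
  move=> r01; have /andP[r0 r1] := r01.
  have c1 : (1 - r / 2) ^+ k @[k --> \oo] --> (0 : R).
    by apply: cvg_expr; rewrite ger0_norm; lra.
  have c2 : 1 - (1 - r / 2) ^+ k @[k --> \oo] --> (1 : R).
    by rewrite -[X in _ --> X]subr0; apply: cvgB => //; exact: cvg_cst.
  apply: (@squeeze_cvgr _ _ _ _ (fun k => 1 - (1 - r / 2) ^+ k) (fun _ => 1)) => //.
    apply: nearW => k; have [/andP[_ a] b] := cubic_iter_pos k r01.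
    by apply/andP; split=> //; lra.
  exact: cvg_cst.
move=> s1; have [s0|s0|->] := ltgtP s 0.
- rewrite ltr0_sg// (_ : (fun k => _) = fun k => - iter k cubic (- s)).
    apply: cvgN; apply: pos; rewrite oppr_gt0 s0 /=.
    by move: s1; rewrite ltr0_norm.
  by apply/funext => k; rewrite cubic_iterN opprK.
- by rewrite gtr0_sg//; apply: pos; rewrite s0 /= (le_trans (ler_norm _)).
- rewrite sgr0 (_ : (fun k => _) = fun _ => 0); first exact: cvg_cst.
  by apply/funext; elim => //= k ->; rewrite /cubic; field.
Qed.

Lemma sg_sin_small x : `|x| < 2 -> Num.sg (sin x) = Num.sg x.
Proof.
rewrite ltr_norml => /andP[x1 x2].
have [x0|x0|->] := ltgtP x 0; last by rewrite sin0.
- rewrite (ltr0_sg x0) ltr0_sg// -oppr_gt0 -sinN; apply: sin2_gt0.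
  by rewrite oppr_gt0 x0 /=; lra.
- by rewrite !gtr0_sg//; apply: sin2_gt0; rewrite x0.
Qed.

End sign_iteration.

(** * Factors preserving annihilation *)

Section stable_factors.
Context d (T : measurableType d) (R : realType).
Variable mu : {measure set T -> \bar R}.
Variable G : set (T -> R).
Hypothesis Gi : forall h, G h -> rintegrable mu h.
Implicit Types (f h l psi : T -> R).
Local Notation annihilated := (annihilated mu G).

(** Stability is required against all annihilated f bounded by 1, and not only
    against f = 1, so that stable functions can be multiplied. *)
Definition stable psi := [/\ measurable_fun setT psi, forall x, `|psi x| <= 1 &
  forall f, (forall x, `|f x| <= 1) -> annihilated f -> annihilated (fun x => f x * psi x)].

Lemma norm_mul_le1 (a b : R) : `|a| <= 1 -> `|b| <= 1 -> `|a * b| <= 1.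
Proof. by move=> a1 b1; rewrite normrM mulr_ile1. Qed.

Lemma stable_lim (F : nat -> T -> R) psi : (forall k, stable (F k)) ->
  (forall x, F k x @[k --> \oo] --> psi x) -> stable psi.
Proof.
move=> sF Fpsi; split.
- by apply: (@measurable_fun_cvg _ _ _ _ F) => [k|x _]; [case: (sF k)|exact: Fpsi].
- move=> x; have b k : -1 <= F k x <= 1 by rewrite -ler_norml; case: (sF k).
  have c (y : R) : (fun _ : nat => y) @ \oo --> y by exact: cvg_cst.
  rewrite ler_norml; apply/andP; split.
    by apply: (ler_cvg_to (c _) (Fpsi x)); apply: nearW => k; case/andP: (b k).
  by apply: (ler_cvg_to (Fpsi x) (c _)); apply: nearW => k; case/andP: (b k).
- move=> f f1 fann; apply: (@annihilated_lim _ _ _ mu G (fun k x => f x * F k x) _ (fun _ => 1)).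
  + by move=> k; case: (sF k) => _ _; exact.
  + by move=> k x; apply: norm_mul_le1 => //; case: (sF k).
  + by move=> x; apply: cvgM; [exact: cvg_cst|exact: Fpsi].
  + move=> h Gh; have mh := rintegrable_measurable (Gi Gh); split => //.
    apply: rintegrable_le (rintegrable_norm (Gi Gh)).
      by apply: measurable_funM => //; exact: measurableT_comp.
    by move=> x; rewrite mulr1 normr_id.
Qed.

Lemma stableM psi psi' : stable psi -> stable psi' ->
  stable (fun x => psi x * psi' x).
Proof.
move=> [m1 b1 a1] [m2 b2 a2]; split=> [|x|f f1 fann].
- exact: measurable_funM.
- exact: norm_mul_le1.
- apply: eq_annihilated (a2 _ _ (a1 f f1 fann)) => x; first by rewrite mulrA.
  exact: norm_mul_le1.
Qed.

Lemma stable_comb (a b : R) psi psi' : stable psi -> stable psi' ->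
  (forall x, `|a * psi x + b * psi' x| <= 1) ->
  stable (fun x => a * psi x + b * psi' x).
Proof.
move=> [m1 b1 a1] [m2 b2 a2] ab; split=> [||f f1 fann].
- by apply: measurable_funD; apply: measurable_funM.
- exact: ab.
- apply: eq_annihilated (annihilatedD (annihilatedZ a (a1 f f1 fann))
    (annihilatedZ b (a2 f f1 fann))) => x.
  by rewrite mulrDr !mulrA ![f x * _]mulrC.
Qed.

Lemma stable_cst1 : stable (fun _ => 1).
Proof.
split=> [||f f1 fann]; [exact: measurable_cst|by rewrite normr1|].
by apply: eq_annihilated fann => x; rewrite mulr1.
Qed.

(** The values of a factor matter only where the weights do not vanish. *)
Lemma stable_vanish psi psi' : measurable_fun setT psi ->
  (forall x, `|psi x| <= 1) ->
  (forall h x, G h -> h x * psi x = h x * psi' x) -> stable psi' -> stable psi.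
Proof.
move=> m1 b1 hpsi [m2 b2 a2]; split=> // f f1 fann.
have [mf Hf] := a2 f f1 fann; split=> [|h Gh].
  by apply: measurable_funM => //; case: fann.
have := Hf h Gh; rewrite (_ : (fun x => h x * (f x * psi' x)) =
  fun x => h x * (f x * psi x))//.
by apply/funext => x; rewrite mulrCA -hpsi// mulrCA.
Qed.

Section sine.
Variable l : T -> R.
Hypotheses (ml : measurable_fun setT l) (Ml : multiplier mu G l).
Hypothesis el : forall h, G h -> rintegrable mu (fun x => `|h x| * expR `|l x|).

(** The Taylor sums are polynomials in l, hence multipliers, and they are bounded
    by e^|l|, against which the weights are integrable. *)
Lemma stable_sin : stable (fun x => sin (l x)).
Proof.
split.
- apply: measurableT_comp => //; apply: continuous_measurable_fun.
  exact: continuous_sin.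
- by move=> x; exact: sin_max.
move=> f f1 fann.
apply: (@annihilated_lim _ _ _ mu G
  (fun N x => \sum_(0 <= k < N) (sin_coeff (l x) k * f x)) _
  (fun x => expR `|l x|)).
- move=> N; apply: annihilated_sum => k.
  pose c : R := (odd k)%:R * (-1) ^+ k.-1./2 / k`!%:R.
  apply: eq_annihilated (annihilatedZ c (multiplierX k Ml fann)) => x.
  by rewrite /c /sin_coeff /=; ring.
- move=> N x; rewrite -mulr_suml normrM; apply: le_trans (norm_series_sin_coeff_le _ N).
  by rewrite ler_piMr.
- move=> x; rewrite mulrC (_ : (fun N => _) = fun N => series (sin_coeff (l x)) N * f x).
    by apply: cvgM; [exact: cvg_series_sin_coeff|exact: cvg_cst].
  by apply/funext => N; rewrite -mulr_suml.
- by move=> h Gh; split; [exact: rintegrable_measurable (Gi Gh)|exact: el].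
Qed.

(** The iterates of a cubic polynomial at sin l are again built from products and
    combinations of stable functions; pass to the bounded limit. *)
Lemma stable_sg_sin : stable (fun x => Num.sg (sin (l x))).
Proof.
apply: (@stable_lim (fun k x => iter k (@cubic R) (sin (l x)))); last first.
  by move=> x; apply: cvg_cubic_iter; exact: sin_max.
elim => [|k IH]; first exact: stable_sin.
have cb x : `|iter k (@cubic R) (sin (l x))| <= 1.
  by apply: cubic_iter_norm; exact: sin_max.
have E : (fun x => iter k.+1 (@cubic R) (sin (l x))) = fun x =>
    3 / 2 * iter k (@cubic R) (sin (l x)) + - 2^-1 *
    (iter k (@cubic R) (sin (l x)) * iter k (@cubic R) (sin (l x)) *
     iter k (@cubic R) (sin (l x))).
  by apply/funext => x; rewrite /= {1}/cubic; field.
rewrite E; apply: stable_comb => //; first by do 2 apply: stableM => //.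
move=> x; have := cubic_iter_norm k.+1 (sin_max (l x)).
by have /(congr1 (@^~ x)) /= := E => ->.
Qed.

End sine.

(** The sign of sin (l / (k + 1)) equals that of l as soon as |l| < k. *)
Lemma stable_sg l : measurable_fun setT l -> multiplier mu G l ->
  (forall h, G h -> rintegrable mu (fun x => `|h x| * expR `|l x|)) ->
  stable (fun x => Num.sg (l x)).
Proof.
move=> ml Ml el.
apply: (@stable_lim (fun k x => Num.sg (sin (k.+1%:R^-1 * l x)))) => [k|x].
  apply: stable_sg_sin.
  - exact: measurable_funM.
  - by apply: multiplierM => //; exact: multiplier_cst.
  move=> h Gh; apply: rintegrable_le (el h Gh).
    apply: measurable_funM.
      by apply: measurableT_comp => //; exact: rintegrable_measurable (Gi Gh).
    apply: measurableT_comp => //; apply: measurableT_comp => //.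
    exact: measurable_funM.
  move=> x; rewrite normrM normr_id ger0_norm ?expR_ge0//.
  rewrite ler_wpM2l// ler_expR normrM ger0_norm ?invr_ge0//.
  by rewrite ler_piMl// invf_le1// ler1n.
apply: cvg_near_cst.
near=> k.
rewrite sg_sin_small.
  by rewrite sgrM gtr0_sg ?mul1r// invr_gt0.
rewrite normrM ger0_norm ?invr_ge0// mulrC ltr_pdivrMr//.
have : `|l x| < k%:R by near: k; exact: nbhs_infty_gtr.
move=> lk; apply: lt_trans lk _; rewrite -[k.+1]addn1 natrD.
by have : 0 <= k%:R :> R by []; lra.
Unshelve. all: by end_near. Qed.

End stable_factors.

(** * The sigma-algebra of stable sets *)

Section stable_sets.
Context d (T : measurableType d) (R : realType).
Variable mu : {measure set T -> \bar R}.
Variable G : set (T -> R).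
Hypothesis Gi : forall h, G h -> rintegrable mu h.
Implicit Types (f h l psi : T -> R) (A B : set T).
Local Notation stable := (stable mu G).

Definition stable_set A := stable (\1_A : T -> R).

Lemma stable_set0 : stable_set set0.
Proof.
have E : (\1_set0 : T -> R) = fun x => 0 * 1 + 0 * 1.
  by apply/funext => x; rewrite indic0 !mul0r addr0.
rewrite /stable_set E; apply: stable_comb; [exact: stable_cst1|exact: stable_cst1|].
by move=> x; rewrite !mul0r addr0 normr0.
Qed.

Lemma norm_indic_le1 A x : `|(\1_A : T -> R) x| <= 1.
Proof. by rewrite indicE; case: (x \in A); rewrite ?normr1 ?normr0. Qed.

Lemma stable_setC A : stable_set A -> stable_set (~` A).
Proof.
move=> sA; have E : (\1_(~` A) : T -> R) = fun x => 1 * 1 + -1 * (\1_A : T -> R) x.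
  apply/funext => x; rewrite !indicE in_setC.
  by case: (x \in A); rewrite /= ?mulr1 ?mulr0 ?addr0 ?subrr.
rewrite /stable_set E; apply: stable_comb => //; first exact: stable_cst1.
by move=> x; rewrite -[X in `|X|]/((fun x => 1 * 1 + -1 * (\1_A : T -> R) x) x) -E
  norm_indic_le1.
Qed.

Lemma stable_setI A B : stable_set A -> stable_set B -> stable_set (A `&` B).
Proof.
move=> sA sB; rewrite /stable_set (_ : \1_ _ = fun x => (\1_A : T -> R) x * (\1_B : T -> R) x).
  exact: stableM.
by apply/funext => x; rewrite indicI.
Qed.

Lemma stable_setU A B : stable_set A -> stable_set B -> stable_set (A `|` B).
Proof.
move=> sA sB; rewrite -(setCK (A `|` B)) setCU.
by apply/stable_setC/stable_setI; exact: stable_setC.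
Qed.

Lemma stable_bigcup (F : (set T)^nat) : (forall k, stable_set (F k)) ->
  stable_set (\bigcup_k F k).
Proof.
move=> sF; pose U N := \big[setU/set0]_(k < N) F k.
apply: (@stable_lim _ _ _ mu G Gi (fun N => \1_(U N) : T -> R)).
  elim => [|N IH]; first by rewrite /U big_ord0; exact: stable_set0.
  by rewrite /U big_ord_recr; exact: stable_setU.
move=> x; apply: cvg_near_cst.
have [[k _ Fkx]|nF] := pselect ((\bigcup_k F k) x).
  near=> N; rewrite !indicE [x \in \bigcup_k F k]mem_set; last by exists k.
  rewrite mem_set// /U -bigcup_mkord; exists k => //=.
  by near: N; exact: nbhs_infty_gt.
apply: nearW => N; rewrite !indicE [x \in \bigcup_k F k]memNset// memNset//.
by rewrite /U -bigcup_mkord => -[k _ Fkx]; apply: nF; exists k.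
Unshelve. all: by end_near. Qed.

Lemma sigma_algebra_stable_set : sigma_algebra setT stable_set.
Proof.
split; [exact: stable_set0| |exact: stable_bigcup].
by move=> A; rewrite setTD; exact: stable_setC.
Qed.

Lemma stable_set_gt0 l : measurable_fun setT l -> multiplier mu G l ->
  (forall h, G h -> rintegrable mu (fun x => `|h x| * expR `|l x|)) ->
  stable_set [set x | 0 < l x].
Proof.
move=> ml Ml el; have sl := stable_sg Gi ml Ml el.
(* The indicator of {l > 0} is (sg l + (sg l)^2) / 2. *)
have E : (\1_[set x | 0 < l x] : T -> R) = fun x => 2^-1 * Num.sg (l x) +
    2^-1 * (Num.sg (l x) * Num.sg (l x)).
  apply/funext => x; rewrite indicE.
  have [l0|l0|l0] := ltgtP (l x) 0.
  - by rewrite memNset /= ?ltr0_sg//; [lra|rewrite lt_gtF].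
  - by rewrite mem_set//= gtr0_sg//; lra.
  - by rewrite memNset /= ?l0 ?sgr0 ?ltxx//; lra.
rewrite /stable_set E; apply: stable_comb => //; first exact: stableM.
by move=> x; have /(congr1 (@^~ x)) /= <- := E; exact: norm_indic_le1.
Qed.

(** The integral of h over every measurable set is 0. *)
Lemma stable_set_ae0 h : (forall A, measurable A -> stable_set A) ->
  annihilated mu G (fun _ => 1) -> G h -> {ae mu, forall x, h x = 0}.
Proof.
move=> sA a1 Gh.
have hi := Gi Gh.
have : ae_eq mu setT (EFin \o h) (cst 0%E).
  apply: integral_ae_eq => // E _ mE; rewrite integral0.
  have [_ _ /(_ (fun _ => 1))] := sA E mE.
  move=> /(_ _ a1)[|_ /(_ h Gh)[i1 z1]]; first by move=> x; rewrite normr1.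
  rewrite integral_mkcond -[RHS]/(0%R%:E) -z1 fineK; last exact: integrable_fin_num.
  apply: eq_integral => x _; rewrite patchE indicE mul1r.
  by case: (x \in E); rewrite ?mulr1 ?mulr0.
apply: filterS => x /(_ I) /= [] //.
Qed.

End stable_sets.

(** * A function with vanishing moments is zero *)

(** Sign conditions on affine forms yield the half-spaces {xi_j > c}.  Off the
    hyperplane xi_j0 = 0, where g vanishes, the condition t > c is expressed by
    the signs of xi_j0 and of xi_j0 (t - c).  These sets generate the Borel sets
    of spacetime. *)
Section moments.
Variables (R : realType) (n : nat) (j0 : 'I_n).
Local Notation mu := (lebesgue_spacetime R n).
Local Notation V := ('rV[R]_n * measurableTypeR R)%type.
Implicit Types (p : V) (s : seq 'I_n) (m : nat).

(** Affine in the pair (xi_j, xi_j t); t alone is not available, as multiplying by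
    it would raise m without raising the degree in xi. *)
Definition affine_form (j : 'I_n) (al be ga : R) (p : V) : R :=
  al + be * p.1 ord0 j + ga * (p.1 ord0 j * p.2).

Lemma measurable_affine_form j al be ga :
  measurable_fun setT (affine_form j al be ga).
Proof.
have mj := @measurable_space_coord R n j.
apply: measurable_funD; first by apply: measurable_funD => //; exact: measurable_funM.
by apply: measurable_funM => //; apply: measurable_funM => //; exact: measurable_time.
Qed.

Lemma measurable_mono s m : measurable_fun [set: V] (mono s m : V -> R).
Proof.
apply: measurable_funM; last by apply: measurable_funX; exact: measurable_time.
elim: s => [|j s IH].
  rewrite (_ : (fun _ => _) = cst 1); first exact: measurable_cst.
  by apply/funext => p; rewrite big_nil.
rewrite (_ : (fun _ => _) = fun p : V => p.1 ord0 j * \prod_(i <- s) p.1 ord0 i).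
  by apply: measurable_funM => //; exact: measurable_space_coord.
by apply/funext => p; rewrite big_cons.
Qed.

Variable g : V -> R.
Hypothesis g_vanish : forall p, p.1 ord0 j0 = 0 -> g p = 0.
Hypothesis g_exp : forall s m j al be ga, (m <= size s)%N ->
  rintegrable mu (fun p => `|g p * mono s m p| * expR `|affine_form j al be ga p|).
Hypothesis mg : measurable_fun setT g.
Hypothesis g_moments : forall s m, (m <= size s)%N ->
  \int[mu]_p (g p * mono s m p) = 0.

Let G : set (V -> R) := [set h | exists s m, (m <= size s)%N /\
  h = fun p => g p * mono s m p].

Let Gi h : G h -> rintegrable mu h.
Proof.
move=> [s [m [ms ->]]]; apply: rintegrable_le (g_exp j0 0 0 0 ms).
  by apply: measurable_funM => //; exact: measurable_mono.
by move=> p; rewrite ler_peMr// -expR0 ler_expR.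
Qed.

Let G1 : annihilated mu G (fun _ => 1).
Proof.
split=> [|h Gh]; first exact: measurable_cst.
rewrite (_ : (fun x => _) = h); last by apply/funext => p; rewrite mulr1.
split; first exact: Gi.
by have [s [m [ms ->]]] := Gh; exact: g_moments.
Qed.

Let mult_affine j al be ga : multiplier mu G (affine_form j al be ga).
Proof.
have Mx : multiplier mu G (fun p : V => p.1 ord0 j).
  apply: multiplier_stable; first exact: measurable_space_coord.
  move=> h [s [m [ms ->]]]; exists (j :: s), m; split; first exact: leqW.
  by apply/funext => p; rewrite /mono big_cons; ring.
have Mt : multiplier mu G (fun p : V => p.1 ord0 j * p.2).
  apply: multiplier_stable.
    by apply: measurable_funM; [exact: measurable_space_coord|exact: measurable_time].
  move=> h [s [m [ms ->]]]; exists (j :: s), m.+1; split=> //.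
  by apply/funext => p; rewrite /mono big_cons exprS; ring.
apply: multiplierD; first apply: multiplierD; first exact: multiplier_cst.
  by apply: multiplierM => //; exact: multiplier_cst.
by apply: multiplierM => //; exact: multiplier_cst.
Qed.

Let stable_affine j al be ga :
  stable_set mu G [set p | 0 < affine_form j al be ga p].
Proof.
apply: stable_set_gt0 => //; first exact: measurable_affine_form.
by move=> h [s [m [ms ->]]]; exact: g_exp.
Qed.

Let stable_coord j c : stable_set mu G [set p : V | c < p.1 ord0 j].
Proof.
rewrite (_ : mkset _ = [set p | 0 < affine_form j (- c) 1 0 p]) //.
by apply/seteqP; split => p /=; rewrite /affine_form mul1r mul0r addr0 addrC subr_gt0.
Qed.

Let stable_time c : stable_set mu G [set p : V | c < p.2].
Proof.
pose A : set V := ([set p | 0 < affine_form j0 0 1 0 p] `&`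
    [set p | 0 < affine_form j0 0 (- c) 1 p]) `|`
  ([set p | 0 < affine_form j0 0 (-1) 0 p] `&`
    [set p | 0 < affine_form j0 0 c (-1) p]).
have sA : stable_set mu G A.
  by apply: stable_setU; apply: stable_setI.
apply: stable_vanish sA; last 1 first.
- move=> h p [s [m [ms ->]]] /=.
  have [p0|p0] := eqVneq (p.1 ord0 j0) 0; first by rewrite g_vanish// !mul0r.
  congr (_ * _); rewrite !indicE; congr ((nat_of_bool _)%:R).
  apply/idP/idP; rewrite !inE /A /affine_form /=.
    move=> cp; move: p0; rewrite neq_lt => /orP[p0|p0]; [right|left]; split; nra.
  by move=> [[a b]|[a b]]; nra.
- apply: measurable_indic.
  rewrite (_ : mkset _ = (fun p : V => p.2 : R) @^-1` `]c, +oo[%classic).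
    by rewrite -[X in measurable X]setTI; exact: measurable_time.
  by apply/seteqP; split => p /=; rewrite in_itv /= andbT.
- by move=> x; exact: norm_indic_le1.
Qed.

Lemma moments_ae0 : {ae mu, forall p, g p = 0}.
Proof.
have G0 : G g.
  exists [::], 0%N; split=> //; apply/funext => p.
  by rewrite /mono big_nil expr0 !mulr1.
apply: (stable_set_ae0 Gi _ G1 G0) => A mA.
have SE : <<s stable_set mu G >> = stable_set mu G.
  by apply: sigma_algebra_id; exact: sigma_algebra_stable_set.
(* Measurability of the identity from the stable sets to the Borel sets is checked on coordinates. *)
pose W := g_sigma_algebraType (stable_set mu G).
have idm : measurable_fun [set: W] (fun p : W => (p : V)).
  apply/measurable_fun_pairP; split => /=.
    apply: measurable_fun_rVP => j.
    apply: (measurability _ (RGenOInfty.measurableE R)) => // _ [_ [x ->] <-].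
    rewrite setTI; apply: sub_sigma_algebra.
    rewrite (_ : _ @^-1` _ = [set p : V | x < p.1 ord0 j]) //.
    by apply/seteqP; split => p /=; rewrite /rV_coor in_itv /= andbT.
  apply: (measurability _ (RGenOInfty.measurableE R)) => // _ [_ [x ->] <-].
  rewrite setTI; apply: sub_sigma_algebra.
  rewrite (_ : _ @^-1` _ = [set p : V | x < p.2]) //.
  by apply/seteqP; split => p /=; rewrite in_itv /= andbT.
have := idm measurableT A mA; rewrite setTI => mA'.
by rewrite -SE; exact: mA'.
Qed.

End moments.

(** * Pointwise bounds on the weighted monomials *)

Section domination.
Variables (R : realType) (n : nat).
Local Notation mu := (lebesgue_spacetime R n).
Local Notation V := ('rV[R]_n * measurableTypeR R)%type.
Implicit Types (p : V) (s : seq 'I_n) (m : nat).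

Let r2 p : R := sqr_norm p.1.
Let T p : R := 1 + p.2 ^+ 2.
(** This is |w|^2 for w = xi (t - i). *)
Definition sqr_norm_w p : R := sqr_norm p.1 * (1 + p.2 ^+ 2).
Let z := sqr_norm_w.

Let r2_ge0 p : 0 <= r2 p. Proof. exact: sqr_norm_ge0. Qed.
Let T_ge1 p : 1 <= T p. Proof. by rewrite /T lerDl sqr_ge0. Qed.
Let T_gt0 p : 0 < T p. Proof. exact: lt_le_trans (T_ge1 p). Qed.
Let z_ge0 p : 0 <= z p. Proof. by apply: mulr_ge0; [exact: r2_ge0|exact: ltW (T_gt0 p)]. Qed.
Let r2_le_z p : r2 p <= z p. Proof. by apply: ler_peMr; [exact: r2_ge0|exact: T_ge1]. Qed.

(** Squaring, (xi^s)^2 <= |xi|^(2 N) and t^(2 m) (1 + t^2)^(2 (n + 2)) <= (1 + t^2)^N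
    for N = size s: the surplus of the degree in xi over the degree in t is
    traded for decay in t. *)
Lemma mono_bound s m p : (m + n.+2.*2 <= size s)%N ->
  `|mono s m p| * T p ^+ n.+2 <= 1 + z p ^+ size s.
Proof.
move=> ms; have zN : 0 <= z p ^+ size s by rewrite exprn_ge0.
have Tn0 : 0 <= T p ^+ n.+2 by rewrite exprn_ge0// ltW.
rewrite -(@ler_pXn2r _ 2) ?nnegrE//; first last.
- by rewrite addr_ge0.
- by rewrite mulr_ge0.
apply: (@le_trans _ _ (z p ^+ size s)); last first.
  by have := sqr_ge0 (z p ^+ size s); nra.
have -> : (`|mono s m p| * T p ^+ n.+2) ^+ 2 =
    (\prod_(j <- s) p.1 ord0 j) ^+ 2 * ((p.2 ^+ 2) ^+ m * T p ^+ n.+2.*2).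
  rewrite exprMn real_normK ?num_real// /mono exprMn [(p.2 ^+ m) ^+ 2]exprAC.
  by rewrite -mulrA -[(T p ^+ n.+2) ^+ 2]exprM muln2.
have prod_le : (\prod_(j <- s) p.1 ord0 j) ^+ 2 <= r2 p ^+ size s.
  elim: s {ms zN} => [|j s IH]; first by rewrite big_nil !expr1n.
  rewrite big_cons exprMn [leRHS]exprS ler_pM ?sqr_ge0//.
  exact: coord_le_sqr_norm.
rewrite /z /sqr_norm_w [leRHS]exprMn; apply: ler_pM => //; first exact: sqr_ge0.
  by apply: mulr_ge0; apply: exprn_ge0; [exact: sqr_ge0|exact: ltW (T_gt0 p)].
apply: (@le_trans _ _ (T p ^+ m * T p ^+ n.+2.*2)).
  rewrite ler_wpM2r ?exprn_ge0 ?(ltW (T_gt0 _))//.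
  by rewrite lerXn2r ?nnegrE ?sqr_ge0 ?(ltW (T_gt0 _))// /T lerDr.
by rewrite -exprD; apply: ler_weXn2l.
Qed.

Lemma affine_form_bound (j : 'I_n) al be ga p :
  `|affine_form j al be ga p| <= `|al| + 4 * be ^+ 2 + 4 * ga ^+ 2 + z p / 8.
Proof.
(* Young: |c x| <= (2 c)^2 + (x / 4)^2; both xi_j^2 and (xi_j t)^2 are at most |w|^2. *)
have amgm (c x : R) : x ^+ 2 <= z p -> `|c * x| <= 4 * c ^+ 2 + z p / 16.
  move=> xz; rewrite ler_norml.
  have := sqr_ge0 (2 * c + x / 4); have := sqr_ge0 (2 * c - x / 4).
  by move=> h1 h2; apply/andP; split; nra.
have jz := coord_le_sqr_norm p.1 j.
have h1 := amgm be (p.1 ord0 j) (le_trans jz (r2_le_z p)).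
have h2 : `|ga * (p.1 ord0 j * p.2)| <= 4 * ga ^+ 2 + z p / 16.
  apply: amgm; rewrite exprMn ler_pM ?sqr_ge0//.
  by rewrite lerDr.
have := ler_normD (al + be * p.1 ord0 j) (ga * (p.1 ord0 j * p.2)).
have := ler_normD al (be * p.1 ord0 j).
by rewrite /affine_form; lra.
Qed.

Lemma polyexp_bound N : exists2 C : R, 0 <= C &
  forall x, 0 <= x -> (1 + x) * (1 + x ^+ N) <= C * expR (x / 4).
Proof.
exists (1 + 4 + 4 ^+ N * N`!%:R + 4 ^+ N.+1 * N.+1`!%:R).
  by rewrite !addr_ge0// mulr_ge0// exprn_ge0.
move=> x x0; have x4 : 0 <= x / 4 by rewrite divr_ge0.
have pw k : x ^+ k <= 4 ^+ k * k`!%:R * expR (x / 4).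
  have := expn_le_expR k x4; rewrite expr_div_n ler_pdivrMr ?exprn_gt0//.
  by rewrite -mulrA [X in _ -> _ <= X]mulrC.
have e1 : 1 <= expR (x / 4) by rewrite -[leLHS]expR0 ler_expR.
have := pw 1%N; rewrite !expr1 (_ : 1`! = 1%N)// mulr1 => h1.
have := pw N; have := pw N.+1.
rewrite mulrDl mul1r mulrDr mulr1 -exprS !mulrDl; lra.
Qed.

(** Of the exponent - |w|^2 / 2, one quarter of |w|^2 pays for the polynomials and one
    eighth for the affine form; - |w|^2 / 8 is left.  The factor
    (1 + t^2) (1 + |w|^2) makes room for the derivatives of the bump. *)
Lemma domination_bound s m : (m + n.+2.*2 <= size s)%N ->
  forall al be ga, exists2 C : R, 0 <= C & forall j p,
  ground p * `|mono s m p| * (T p * (1 + z p)) * expR `|affine_form j al be ga p| <=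
  C * (((1 + p.2 ^+ 2)^-1) ^+ n.+1 * expR (- (z p / 8))).
Proof.
move=> ms al be ga; have [C C0 HC] := polyexp_bound (size s).
exists (C * expR (`|al| + 4 * be ^+ 2 + 4 * ga ^+ 2)).
  by rewrite mulr_ge0// expR_ge0.
move=> j p; rewrite -/(T p).
have z0 := z_ge0 p; have Tp := T_gt0 p.
have e1 : expR `|affine_form j al be ga p| <=
    expR (`|al| + 4 * be ^+ 2 + 4 * ga ^+ 2) * expR (z p / 8).
  by rewrite -expRD ler_expR; exact: affine_form_bound.
have e2 : `|mono s m p| * (T p * (1 + z p)) <= (T p)^-1 ^+ n.+1 * (C * expR (z p / 4)).
  rewrite exprVn ler_pdivlMl ?exprn_gt0//.
  apply: le_trans (HC _ z0).
  have -> : T p ^+ n.+1 * (`|mono s m p| * (T p * (1 + z p))) =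
      (1 + z p) * (`|mono s m p| * T p ^+ n.+2).
    by rewrite [T p ^+ n.+2]exprS; ring.
  by rewrite ler_wpM2l ?addr_ge0// mono_bound.
have e3 : ground p = expR (- (z p / 2)) by [].
rewrite e3 -mulrA.
apply: (@le_trans _ _ (expR (- (z p / 2)) * (((T p)^-1 ^+ n.+1 * (C * expR (z p / 4))) *
   (expR (`|al| + 4 * be ^+ 2 + 4 * ga ^+ 2) * expR (z p / 8))))).
  rewrite -mulrA ler_wpM2l ?expR_ge0// mulrA ler_pM ?expR_ge0//.
  by apply: mulr_ge0 => //; apply: mulr_ge0; [exact: ltW|rewrite addr_ge0].
have -> : expR (- (z p / 8)) = expR (- (z p / 2)) * expR (z p / 4) * expR (z p / 8).
  by rewrite -!expRD; congr expR; field.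
rewrite le_eqVlt; apply/orP; left; apply/eqP; ring.
Qed.

(** From x y <= x^2 + y^2 with x = |c| and y = e^(- |xi|^2 / 8). *)
Lemma le_envelope (q c : V -> R) p : (c p) ^+ 2 <= q p ->
  `|c p| * (((1 + p.2 ^+ 2)^-1) ^+ n.+1 * expR (- (z p / 8))) <= envelope q p.
Proof.
move=> cq; rewrite /envelope mulrA mulrAC ler_wpM2r ?exprn_ge0 ?invr_ge0 ?(ltW (T_gt0 p))//.
have e1 : expR (- (z p / 8)) <= expR (- (r2 p / 8)).
  by rewrite ler_expR lerN2 ler_wpM2r.
have e2 : expR (- (r2 p / 4)) = expR (- (r2 p / 8)) ^+ 2.
  by rewrite expr2 -expRD; congr expR; field.
rewrite -/(r2 p) e2; have e0 := expR_ge0 (- (r2 p / 8)).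
apply: (@le_trans _ _ (`|c p| * expR (- (r2 p / 8)))); first by rewrite ler_wpM2l.
have := sqr_ge0 (`|c p| - expR (- (r2 p / 8))).
have := real_normK (num_real (c p)).
have := normr_ge0 (c p).
by move: (`|c p|) (expR _) e0 => x y *; nra.
Qed.

End domination.

(** * The recurrence for the moments *)

Section recurrence.
Variables (R : realType) (n : nat) (j0 : 'I_n).
Local Notation mu := (lebesgue_spacetime R n).
Local Notation V := ('rV[R]_n * measurableTypeR R)%type.
Implicit Types (p : V) (s : seq 'I_n) (m k : nat).
Variables (q : V -> R).
Hypothesis Wi : rintegrable mu (envelope q).

Let decay p : R := ((1 + p.2 ^+ 2)^-1) ^+ n.+1 * expR (- (sqr_norm_w p / 8)).

Let decay_ge0 p : 0 <= decay p.
Proof.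
by rewrite mulr_ge0 ?expR_ge0// exprn_ge0// invr_ge0 addr_ge0// sqr_ge0.
Qed.

Lemma rintegrable_dominated (c F : V -> R) (C : R) : measurable_fun setT F ->
  0 <= C -> (forall p, c p ^+ 2 <= q p) ->
  (forall p, `|F p| <= C * (`|c p| *
     (((1 + p.2 ^+ 2)^-1) ^+ n.+1 * expR (- (sqr_norm_w p / 8))))) ->
  rintegrable mu F.
Proof.
move=> mF C0 cq FC; apply: rintegrable_le (rintegrableZ C Wi) => // p.
by apply: le_trans (FC p) _; rewrite ler_wpM2l//; exact: le_envelope.
Qed.

Lemma measurable_ground : measurable_fun [set: V] (@ground R n : V -> R).
Proof.
apply: measurableT_comp => //; apply: measurableT_comp => //.
apply: measurable_funM => //; apply: measurable_funM.
  exact: measurable_spacetime_sqr_norm.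
exact: measurable_oneDtime.
Qed.

Lemma measurable_bump e k : measurable_fun [set: V] (@bump R n e k : V -> R).
Proof.
apply: (@measurableT_comp _ _ _ _ _ _ (@flat R e)).
  by apply: continuous_measurable_fun; exact: (@smooth_flat R e 0%N).
apply: measurable_funB => //; apply: measurable_funM => //.
apply: measurable_funD; first exact: measurable_spacetime_sqr_norm.
by apply: measurable_funX; exact: measurable_time.
Qed.

Lemma cvg_bump e p : bump e k p @[k --> \oo] --> (flat e 1 : R).
Proof.
apply: (@continuous_cvg _ _ _ _ _ _ (@flat R e)); first exact: (@smooth_flat R e 0%N).
rewrite -[X in _ --> X]subr0; apply: cvgB; first exact: cvg_cst.
rewrite -[X in _ --> X](mulr0 (sqr_norm p.1 + p.2 ^+ 2)).
by apply: cvgM; [exact: cvg_cst|exact: cvg_harmonic].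
Qed.

Let X p : R := (1 + p.2 ^+ 2) * (1 + sqr_norm_w p).

Let base_bound s m : (m + n.+2.*2 <= size s)%N ->
  exists2 C : R, 0 <= C & forall p, ground p * `|mono s m p| * X p <= C * decay p.
Proof.
move=> ms; have [C C0 HC] := @domination_bound R n s m ms 0 0 0; exists C => // p.
by have := HC j0 p; rewrite /affine_form !mul0r !addr0 normr0 expR0 mulr1.
Qed.

Section pair.
Variables a b : V -> R.
Hypotheses (ma : measurable_fun setT a) (mb : measurable_fun setT b).
Hypotheses (aq : forall p, a p ^+ 2 <= q p) (bq : forall p, b p ^+ 2 <= q p).

(** Real part of phi times the adjoint operator on a test function, for
    phi / (t - i) = a + i b; the imaginary part is obtained from the pair (b, - a). *)
Definition cutoff_integrand s m k (p : V) : R :=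
  let A := ((size s)%:R - m%:R) * mono s m p in
  let B := m%:R * mono s m.-1 p in
  let C := 2 * (sqr_norm p.1 - p.2 ^+ 2) * mono s m p / k.+1%:R in
  let D := 2 * p.2 * mono s m p / k.+1%:R in
  ground p * (bump 0 k p * (a p * A - b p * B) - bump 2 k p * (a p * C - b p * D)).

Lemma rintegrable_moment s m : (m + n.+2.*2 <= size s)%N ->
  rintegrable mu (fun p => a p * ground p * mono s m p).
Proof.
move=> ms; have [C C0 HC] := base_bound ms.
apply: (@rintegrable_dominated a _ C) => //.
  by apply: measurable_funM; [apply: measurable_funM => //; exact: measurable_ground|
    exact: measurable_mono].
move=> p; rewrite -mulrA normrM [leRHS]mulrCA ler_wpM2l//.
apply: le_trans (HC p); rewrite normrM [`|ground p|]ger0_norm ?expR_ge0//.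
rewrite ler_peMr ?mulr_ge0 ?expR_ge0//.
have := sqr_ge0 p.2; have := sqr_norm_ge0 p.1.
rewrite /X /sqr_norm_w => h1 h2; have h3 : 0 <= sqr_norm p.1 * (1 + p.2 ^+ 2).
  by rewrite mulr_ge0// addr_ge0.
by nra.
Qed.

Lemma measurable_cutoff_integrand s m k :
  measurable_fun setT (cutoff_integrand s m k).
Proof.
have mm s' m' := @measurable_mono R n s' m'.
have mt := @measurable_time R n.
have mr := @measurable_spacetime_sqr_norm R n.
have mA : measurable_fun [set: V] (fun p => ((size s)%:R - m%:R) * mono s m p : R).
  by apply: measurable_funM => //; exact: mm.
have mB : measurable_fun [set: V] (fun p => m%:R * mono s m.-1 p : R).
  by apply: measurable_funM => //; exact: mm.
have mC : measurable_fun [set: V]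
    (fun p => 2 * (sqr_norm p.1 - p.2 ^+ 2) * mono s m p / k.+1%:R : R).
  apply: measurable_funM => //; apply: measurable_funM; last exact: mm.
  apply: measurable_funM => //; apply: measurable_funB => //.
  exact: measurable_funX.
have mD : measurable_fun [set: V] (fun p => 2 * p.2 * mono s m p / k.+1%:R : R).
  apply: measurable_funM => //; apply: measurable_funM; last exact: mm.
  exact: measurable_funM.
apply: measurable_funM; first exact: measurable_ground.
apply: measurable_funB; apply: measurable_funM; try exact: measurable_bump.
  by apply: measurable_funB; exact: measurable_funM.
by apply: measurable_funB; exact: measurable_funM.
Qed.

Lemma cvg_cutoff_integrand s m p : cutoff_integrand s m k p @[k --> \oo] -->
  flat 0 1 * (((size s)%:R - m%:R) * (a p * ground p * mono s m p)
     - m%:R * (b p * ground p * mono s m.-1 p)).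
Proof.
pose L : R := ground p * (flat 0 1 * (a p * (((size s)%:R - m%:R) * mono s m p)
   - b p * (m%:R * mono s m.-1 p)) - flat 2 1 *
   (a p * (2 * (sqr_norm p.1 - p.2 ^+ 2) * mono s m p * 0)
    - b p * (2 * p.2 * mono s m p * 0))).
rewrite (_ : flat 0 1 * _ = L); last by rewrite /L; ring.
have c (y : R) : (fun _ : nat => y) @ \oo --> y by exact: cvg_cst.
have h (y : R) : (fun k : nat => y / k.+1%:R) @ \oo --> y * 0.
  by apply: cvgM => //; exact: cvg_harmonic.
apply: cvgM => //; apply: cvgB; first by apply: cvgM => //; exact: cvg_bump.
apply: cvgM; first exact: cvg_bump.
by apply: cvgB; apply: cvgM => //; exact: h.
Qed.

Lemma cutoff_integrand_bound s m : (m + n.+2.*2 <= size s)%N ->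
  exists2 C : R, 0 <= C & forall k p,
  `|cutoff_integrand s m k p| <= C * (`|a p| * decay p + `|b p| * decay p).
Proof.
move=> ms; have [C0 C00 H0] := base_bound ms.
have ms' : (m.-1 + n.+2.*2 <= size s)%N.
  by apply: leq_trans ms; rewrite leq_add2r leq_pred.
have [C1 C10 H1] := base_bound ms'.
exists (((size s)%:R + m%:R) * C0 + m%:R * C1 + 4 * C0).
  by rewrite !addr_ge0// mulr_ge0.
move=> k p; have h0 := H0 p; have h1 := H1 p.
have z0 : 0 <= sqr_norm_w p.
  by rewrite mulr_ge0 ?sqr_norm_ge0// addr_ge0// sqr_ge0.
have t0 := sqr_ge0 p.2; have r0 := sqr_norm_ge0 p.1.
have rz : sqr_norm p.1 <= sqr_norm_w p by rewrite /sqr_norm_w ler_peMr// lerDl.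
have X1 : 1 <= X p by rewrite /X; nra.
have Xt : `|p.2| <= X p.
  rewrite ler_norml; apply/andP; rewrite /X; have := sqr_ge0 (p.2 - 1);
  have := sqr_ge0 (p.2 + 1); have := mulr_ge0 t0 z0; split; nra.
have Xr : `|sqr_norm p.1 - p.2 ^+ 2| <= X p.
  rewrite ler_norml; apply/andP; rewrite /X; have := mulr_ge0 t0 z0; split; nra.
have g0 : 0 <= ground p by exact: expR_ge0.
set M0 := `|mono s m p| in h0 *; set M1 := `|mono s m.-1 p| in h1 *.
have M00 : 0 <= M0 by exact: normr_ge0.
have M10 : 0 <= M1 by exact: normr_ge0.
have c0 : `|bump 0 k p| <= 1.
  by rewrite ger0_norm ?flat_ge0//; exact: flat_le_fact.
have c2 : `|bump 2 k p| <= 2.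
  by rewrite ger0_norm ?flat_ge0//; exact: flat_le_fact.
have ik : `|k.+1%:R^-1 : R| <= 1.
  by rewrite ger0_norm ?invr_ge0// invf_le1 ?ltr0n// ler1n.
have bA : `|((size s)%:R - m%:R) * mono s m p| <= ((size s)%:R + m%:R) * M0.
  rewrite normrM ler_wpM2r//; apply: le_trans (ler_normB _ _) _.
  by rewrite !ger0_norm.
have bB : `|m%:R * mono s m.-1 p| <= m%:R * M1 by rewrite normrM ger0_norm.
have bC : `|2 * (sqr_norm p.1 - p.2 ^+ 2) * mono s m p / k.+1%:R| <= 2 * X p * M0.
  rewrite -[leRHS]mulr1 normrM ler_pM// normrM ler_wpM2r//.
  by rewrite normrM (ger0_norm (ler0n _ 2)) ler_wpM2l.
have bD : `|2 * p.2 * mono s m p / k.+1%:R| <= 2 * X p * M0.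
  rewrite -[leRHS]mulr1 normrM ler_pM// normrM ler_wpM2r//.
  by rewrite normrM (ger0_norm (ler0n _ 2)) ler_wpM2l.
have comb (x y x' y' : R) : `|x| <= x' -> `|y| <= y' ->
    `|a p * x - b p * y| <= `|a p| * x' + `|b p| * y'.
  move=> hx hy; apply: le_trans (ler_normB _ _) _.
  by rewrite !normrM lerD// ler_wpM2l.
have e0 : ground p * M0 <= C0 * decay p.
  by apply: le_trans h0; rewrite ler_peMr// mulr_ge0.
have e1 : ground p * M1 <= C1 * decay p.
  by apply: le_trans h1; rewrite ler_peMr// mulr_ge0.
rewrite /cutoff_integrand /= normrM (ger0_norm g0).
apply: (@le_trans _ _ (ground p *
  ((`|a p| * (((size s)%:R + m%:R) * M0) + `|b p| * (m%:R * M1))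
   + 2 * (`|a p| * (2 * X p * M0) + `|b p| * (2 * X p * M0))))).
  rewrite ler_wpM2l//; apply: le_trans (ler_normB _ _) _; apply: lerD.
    by rewrite normrM -[leRHS]mul1r ler_pM//; exact: comb.
  by rewrite normrM ler_pM//; exact: comb.
have f1 := ler_wpM2l (mulr_ge0 (normr_ge0 (a p)) (addr_ge0 (ler0n R (size s)) (ler0n R m))) e0.
have f2 := ler_wpM2l (mulr_ge0 (normr_ge0 (b p)) (ler0n R m)) e1.
have f3 := ler_wpM2l (normr_ge0 (a p)) h0.
have f4 := ler_wpM2l (normr_ge0 (b p)) h0.
have u1 := mulr_ge0 (normr_ge0 (a p)) (mulr_ge0 (mulr_ge0 (ler0n R m) C10) (decay_ge0 p)).
have u2 := mulr_ge0 (normr_ge0 (b p))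
  (mulr_ge0 (mulr_ge0 (addr_ge0 (ler0n R (size s)) (ler0n R m)) C00) (decay_ge0 p)).
move: f1 f2 f3 f4 u1 u2; lra.
Qed.

Lemma flat01_neq0 : flat 0 1 != 0 :> R.
Proof. by rewrite /flat ltr01 mulf_neq0// gt_eqF// expR_gt0. Qed.

End pair.

(** Limit of the tested equations: the terms in C and D are O(1 / k), and the bump
    tends to the nonzero constant flat 0 1. *)
Lemma moment_recurrence (a b : V -> R) s m :
  measurable_fun setT a -> measurable_fun setT b ->
  (forall p, a p ^+ 2 <= q p) -> (forall p, b p ^+ 2 <= q p) ->
  (m + n.+2.*2 <= size s)%N ->
  (forall k, \int[mu]_p cutoff_integrand a b s m k p = 0) ->
  ((size s)%:R - m%:R) * \int[mu]_p (a p * ground p * mono s m p)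
   = m%:R * \int[mu]_p (b p * ground p * mono s m.-1 p).
Proof.
move=> ma mb aq bq ms F0; have [C C0 HC] := cutoff_integrand_bound a b ms.
have ms' : (m.-1 + n.+2.*2 <= size s)%N.
  by apply: leq_trans ms; rewrite leq_add2r leq_pred.
have ia := rintegrable_moment ma aq ms.
have ib := rintegrable_moment mb bq ms'.
have [] := @rintegral_dominated _ _ _ mu (cutoff_integrand a b s m) _
  (fun p => (C + C) * envelope q p)
  (measurable_cutoff_integrand ma mb s m)
  (fun p => @cvg_cutoff_integrand a b s m p)
  (rintegrableZ (C + C) Wi).
  move=> k p; apply: le_trans (HC k p) _; rewrite mulrDl -mulrDr ler_wpM2l//.
  by apply: lerD; exact: le_envelope.
move=> _ _ cv.
have {}cv : (fun k : nat => 0 : R) @ \oo --> \int[mu]_p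
    (flat 0 1 * (((size s)%:R - m%:R) * (a p * ground p * mono s m p)
     - m%:R * (b p * ground p * mono s m.-1 p))).
  by move: cv; rewrite (_ : (fun k => _) = fun _ => 0)//; apply/funext.
have := cvg_unique (@Rhausdorff R) cv (cvg_cst (0 : R)).
rewrite RintegralZl//; last first.
  rewrite (_ : _ \o _ = EFin \o (fun p : V => ((size s)%:R - m%:R) *
      (a p * ground p * mono s m p) + - m%:R * (b p * ground p * mono s m.-1 p))).
    by apply: rintegrableD; exact: rintegrableZ.
  by apply/funext => p /=; rewrite mulNr.
move=> /(_ _ _)/eqP; rewrite mulf_eq0 (negbTE flat01_neq0)/= RintegralB//; last 2 first.
- exact: rintegrableZ.
- exact: rintegrableZ.
by rewrite !RintegralZl// subr_eq0 => /eqP.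
Qed.

(** The factor size s - m is nonzero, so the recurrence determines the moments of
    order m from those of order m - 1, starting from 0 at m = 0. *)
Lemma moments_eq0 (a b : V -> R) :
  measurable_fun setT a -> measurable_fun setT b ->
  (forall p, a p ^+ 2 <= q p) -> (forall p, b p ^+ 2 <= q p) ->
  (forall s m k, \int[mu]_p cutoff_integrand a b s m k p = 0) ->
  (forall s m k, \int[mu]_p cutoff_integrand b (fun p => - a p) s m k p = 0) ->
  forall s m, (m + n.+2.*2 <= size s)%N ->
  \int[mu]_p (a p * ground p * mono s m p) = 0 /\
  \int[mu]_p (b p * ground p * mono s m p) = 0.
Proof.
move=> ma mb aq bq Fab Fba s.
have ma' : measurable_fun setT (fun p => - a p) by exact: measurableT_comp.
have aq' p : (- a p) ^+ 2 <= q p by rewrite sqrrN.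
have cancel m (x y : R) : (m + n.+2.*2 <= size s)%N ->
    ((size s)%:R - m%:R) * x = m%:R * y -> y = 0 -> x = 0.
  move=> ms e y0; move: e; rewrite y0 mulr0 => /eqP; rewrite mulf_eq0 subr_eq0 eqr_nat.
  rewrite gtn_eqF; first by move=> /eqP.
  by apply: leq_trans ms; rewrite doubleS addnS ltnS leq_addr.
have cancel0 (x y : R) : (n.+2.*2 <= size s)%N ->
    ((size s)%:R - 0%:R) * x = 0%:R * y -> x = 0.
  by move=> s0; rewrite mul0r -[RHS](mulr0 0%:R) => /(cancel 0%N); exact.
elim=> [|m IH] ms.
  by split; [apply: cancel0 ms (moment_recurrence ma mb aq bq ms (Fab s 0%N))|
    apply: cancel0 ms (moment_recurrence mb ma' bq aq' ms (Fba s 0%N))].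
have ms' := ltnW ms; have [Ia Ib] := IH ms'; split.
  by apply: cancel ms (moment_recurrence ma mb aq bq ms (Fab s m.+1)) Ib.
apply: cancel ms (moment_recurrence mb ma' bq aq' ms (Fba s m.+1)) _.
rewrite [LHS](_ : _ = \int[mu]_p (-1 * (a p * ground p * mono s m p))); last first.
  by apply: eq_Rintegral => p _; rewrite /=; ring.
rewrite RintegralZl ?Ia ?mulr0//.
by apply: (rintegrable_moment ma aq); exact: ms'.
Qed.

End recurrence.

(** * Vanishing almost everywhere *)

Section vanishing.
Variables (R : realType) (n : nat) (j0 : 'I_n).
Local Notation mu := (lebesgue_spacetime R n).
Local Notation V := ('rV[R]_n * measurableTypeR R)%type.
Implicit Types (p : V) (s : seq 'I_n) (m k : nat).

Lemma hyperplane_null : mu.-negligible [set p : V | p.1 ord0 j0 = 0].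
Proof.
pose A (j : 'I_n) : set R := if j == j0 then [set 0] else setT.
pose H : set 'rV[R]_n := [set v | forall j, A j (v ord0 j)].
have mA j : measurable (A j) by rewrite /A; case: ifP.
have mH : measurable H.
  rewrite (_ : H = \bigcap_(j in [set: 'I_n]) (rV_coor j @^-1` A j)).
    apply: fin_bigcap_measurable => [|j _]; first exact: finite_finset.
    by rewrite -[X in measurable X]setTI; exact: (@measurable_rV_coor R n j measurableT _ (mA _)).
  by apply/seteqP; split => [v Av j _|v Av j]; [exact: Av|exact: Av].
exists (H `*` setT); split; first exact: measurableX.
- have -> : mu (H `*` setT) = (lebesgue_rV R n H * @lebesgue_measure R setT)%E.
    exact: product_measure1E.
  rewrite lebesgue_rV_box// (bigD1 j0)//=.
  by rewrite /A eqxx lebesgue_measure_set1 !mul0e.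
- move=> p /= p0; split=> //= j; rewrite /A; case: eqP => [->|] //=.
Qed.

Variables (q : V -> R).
Hypothesis Wi : rintegrable mu (envelope q).

(** Prefixing 2 (n + 2) copies of j0 to s makes every monomial with m <= size s
    admissible, and makes the weight vanish on the hyperplane xi_j0 = 0. *)
Lemma ae0_of_moments (c : V -> R) : measurable_fun setT c ->
  (forall p, c p ^+ 2 <= q p) ->
  (forall s m, (m + n.+2.*2 <= size s)%N ->
     \int[mu]_p (c p * ground p * mono s m p) = 0) ->
  {ae mu, forall p, c p = 0}.
Proof.
move=> mc cq c0; pose s0 := nseq n.+2.*2 j0.
have mono0 s m p : mono s0 0 p * mono s m p = mono (s0 ++ s) m p.
  by rewrite /mono big_cat expr0 mulr1 mulrA.
have size0 s m : (m <= size s)%N -> (m + n.+2.*2 <= size (s0 ++ s))%N.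
  by rewrite size_cat size_nseq addnC leq_add2l.
have mono0E p : mono s0 0 p = p.1 ord0 j0 ^+ n.+2.*2.
  by rewrite /mono expr0 mulr1 /s0 big_nseq; elim: (n.+2.*2) => //= k ->; rewrite exprS.
have mg : measurable_fun [set: V] (fun p : V => c p * ground p).
  by apply: measurable_funM => //; exact: measurable_ground.
have : {ae mu, forall p, c p * ground p * mono s0 0 p = 0}.
  apply: (@moments_ae0 _ _ j0).
  - by move=> p p0; rewrite mono0E p0 expr0n mulr0.
  - move=> s m j al be ga ms.
    have [C C0 HC] := @domination_bound R n (s0 ++ s) m (size0 s m ms) al be ga.
    apply: (@rintegrable_dominated _ _ _ Wi c _ C) => //.
      apply: measurable_funM.
        apply: measurableT_comp => //; apply: measurable_funM; last exact: measurable_mono.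
        by apply: measurable_funM => //; exact: measurable_mono.
      apply: measurableT_comp => //; apply: measurableT_comp => //.
      exact: measurable_affine_form.
    move=> p; have g0 : 0 <= ground p := expR_ge0 _.
    have e0 := expR_ge0 `|affine_form j al be ga p|.
    rewrite ger0_norm ?mulr_ge0// -[_ * _ * mono s m p]mulrA mono0.
    rewrite -[c p * _ * _]mulrA normrM [`|ground p * _|]normrM (ger0_norm g0).
    rewrite -mulrA [leRHS]mulrCA ler_wpM2l//; apply: le_trans (HC j p).
    rewrite ler_wpM2r// ler_peMr ?mulr_ge0//.
    have := sqr_ge0 p.2; have := sqr_norm_ge0 p.1; rewrite /sqr_norm_w => h1 h2.
    have h3 : 0 <= sqr_norm p.1 * (1 + p.2 ^+ 2) by rewrite mulr_ge0// addr_ge0.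
    by rewrite /=; nra.
  - by apply: measurable_funM => //; exact: measurable_mono.
  - move=> s m ms; rewrite -(c0 (s0 ++ s) m (size0 s m ms)).
    by apply: eq_Rintegral => p _; rewrite -mulrA mono0.
move=> H.
have : {ae mu, forall p, ~ (p.1 ord0 j0 = 0 :> R)}.
  by apply: negligibleS hyperplane_null => p /= /contrapT.
move: H; apply: filterS2 => p cp /eqP p0.
have k0 : ground p * p.1 ord0 j0 ^+ n.+2.*2 != 0.
  by apply: mulf_neq0; [rewrite gt_eqF// expR_gt0|exact: expf_neq0].
by apply: (mulIf k0); rewrite mul0r mulrA -mono0E.
Qed.

End vanishing.

(** * Uniqueness *)

(** Squaring turns the exponent n / 4 into n / 2, which is then bounded by n. *)
Lemma slice_bound_of_sup (R : realType) (n : nat) (phi : 'rV[R]_n * R -> R[i]) :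
  (forall t : R, (cL2norm (lebesgue_rV R n) (fun xi => phi (xi, t)) < +oo)%E) ->
  (ereal_sup [set cL2norm (lebesgue_rV R n) (fun xi => phi (xi, t))
                      * (((1 + t ^+ 2) `^ (n%:R / 4))^-1)%:E
                  | t in [set: R]] < +oo)%E ->
  exists2 K : R, 0 <= K & forall t,
  (\int[lebesgue_rV R n]_xi (complex.Re (phi (xi, t)) ^+ 2 +
      complex.Im (phi (xi, t)) ^+ 2)%:E <= (K * (1 + t ^+ 2) ^+ n)%:E)%E.
Proof.
move=> fin; set S := (X in ereal_sup X); move=> bnd.
pose N t := cL2norm (lebesgue_rV R n) (fun xi => phi (xi, t)).
have N0 t : (0 <= N t)%E by exact: Lnorm_ge0.
have Nfin t : N t \is a fin_num by rewrite ge0_fin_numE//; exact: fin.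
have T0 (t : R) : 0 < 1 + t ^+ 2 by rewrite ltr_pwDl// sqr_ge0.
have P0 t : 0 < (1 + t ^+ 2) `^ (n%:R / 4) :> R by exact: powR_gt0.
have leS t : (N t * (((1 + t ^+ 2) `^ (n%:R / 4))^-1)%:E <= ereal_sup S)%E.
  by apply: ereal_sup_ubound; exists t.
have S0 : (0 <= ereal_sup S)%E.
  by apply: le_trans (leS 0); rewrite mule_ge0// lee_fin invr_ge0 ltW.
have Sfin : ereal_sup S \is a fin_num by rewrite ge0_fin_numE.
pose K := fine (ereal_sup S); have K0 : 0 <= K by exact: fine_ge0.
exists (K ^+ 2); first exact: sqr_ge0.
move=> t; have := leS t.
rewrite -(fineK (Nfin t)) -(fineK Sfin) -EFinM lee_fin -/K ler_pdivrMr// => NK.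
apply: le_trans (integral_le_sqr_cL2norm (c := K * (1 + t ^+ 2) `^ (n%:R / 4)) _ _) _.
- by rewrite mulr_ge0// ltW.
- by rewrite -/(N t) -(fineK (Nfin t)) lee_fin.
rewrite lee_fin exprMn ler_wpM2l ?sqr_ge0//.
rewrite -[leLHS]powR_mulrn ?(ltW (P0 t))// -powRrM.
rewrite -[leRHS]powR_mulrn ?(ltW (T0 t))//.
apply: ler_powR; first by rewrite lerDl sqr_ge0.
by have : 0 <= n%:R :> R by []; lra.
Qed.

Lemma quot_eq0 (R : realType) (u w t : R) :
  quot_re u w t = 0 -> quot_im u w t = 0 -> u = 0 /\ w = 0.
Proof.
rewrite /quot_re /quot_im; have T0 : 0 < 1 + t ^+ 2 by rewrite ltr_pwDl// sqr_ge0.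
have inv0 : (1 + t ^+ 2)^-1 != 0 by rewrite invr_eq0 gt_eqF.
move=> /eqP; rewrite mulf_eq0 (negbTE inv0) orbF => /eqP e1.
move=> /eqP; rewrite mulf_eq0 (negbTE inv0) orbF => /eqP e2.
have ww : w = u * t by lra.
have : u * (1 + t ^+ 2) = 0 by rewrite -e2 ww; ring.
move=> /eqP; rewrite mulf_eq0 (gt_eqF T0) orbF => /eqP u0.
by rewrite ww u0 mul0r.
Qed.

(** Both follow from |z / (t - i)| <= |z|. *)
Lemma quot_sqr_le (R : realType) (u w t : R) :
  quot_re u w t ^+ 2 <= u ^+ 2 + w ^+ 2 /\ quot_im u w t ^+ 2 <= u ^+ 2 + w ^+ 2.
Proof.
have T1 : 1 <= 1 + t ^+ 2 by rewrite lerDl sqr_ge0.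
have T0 : 0 < 1 + t ^+ 2 by exact: lt_le_trans T1.
have E : quot_re u w t ^+ 2 + quot_im u w t ^+ 2 = (u ^+ 2 + w ^+ 2) / (1 + t ^+ 2).
  by rewrite /quot_re /quot_im; field; rewrite gt_eqF.
have le : (u ^+ 2 + w ^+ 2) / (1 + t ^+ 2) <= u ^+ 2 + w ^+ 2.
  by rewrite ler_pdivrMr// ler_peMr// addr_ge0// sqr_ge0.
have := sqr_ge0 (quot_re u w t); have := sqr_ge0 (quot_im u w t).
by split; lra.
Qed.

Theorem theorem3 (R : realType) (n : nat) (n_ge1 : (1 <= n)%N)
    (phi : 'rV[R]_n * R -> R[i])
    (phi_meas : completed_measurable_cfun (lebesgue_spacetime R n) phi)
    (phi_L2 : forall t : R, in_cL2 (lebesgue_rV R n) (fun xi => phi (xi, t)))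
    (phi_weak : weak_solution phi)
    (phi_bound :
      (ereal_sup [set cL2norm (lebesgue_rV R n) (fun xi => phi (xi, t))
                      * (((1 + t ^+ 2) `^ (n%:R / 4))^-1)%:E
                  | t in [set: R]] < +oo)%E) :
  {ae lebesgue_spacetime R n, forall p, phi p = 0}.
Proof.
pose mu := lebesgue_spacetime R n.
pose V := ('rV[R]_n * measurableTypeR R)%type.
pose j0 : 'I_n := Ordinal n_ge1.
have [K K0 L2K] := slice_bound_of_sup (fun t => (phi_L2 t).2) phi_bound.
have [mRe mIm] := phi_meas.
have [N1 [mN1 N10] mRe1] := completed_measurable_restrict mRe.
have [N2 [mN2 N20] mIm2] := completed_measurable_restrict mIm.
pose N : set V := N1 `|` N2.
have mN : measurable N by exact: measurableU.
have N0 : mu N = 0%E by rewrite /N null_set_setU.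
pose u : V -> R := (fun p => complex.Re (phi p)) \_ (~` N).
pose w : V -> R := (fun p => complex.Im (phi p)) \_ (~` N).
have uE p : ~ N p -> u p = complex.Re (phi p) by move=> Np; rewrite /u patchE mem_set.
have wE p : ~ N p -> w p = complex.Im (phi p) by move=> Np; rewrite /w patchE mem_set.
have mfu : measurable_fun setT u.
  apply/(measurable_restrictT _ (measurableC mN)).
  by apply: measurable_funS mRe1; [exact: measurableC|apply: subsetC => ?; left].
have mfw : measurable_fun setT w.
  apply/(measurable_restrictT _ (measurableC mN)).
  by apply: measurable_funS mIm2; [exact: measurableC|apply: subsetC => ?; right].
pose q (p : V) := u p ^+ 2 + w p ^+ 2.
have q0 p : 0 <= q p by rewrite addr_ge0// sqr_ge0.
have mq : measurable_fun setT q by apply: measurable_funD; exact: measurable_funX.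
have [M [mM M0] HM] := null_slices mN N0.
have Wi : rintegrable mu (envelope q).
  apply: (integrable_envelope mq q0 mM M0 K0) => t Mt.
  have [mNt Nt0] := HM t Mt; apply: le_trans (L2K t).
  apply: (ge0_le_integral_null mNt Nt0).
  - by move=> x; rewrite lee_fin.
  - by move=> x; rewrite lee_fin addr_ge0// sqr_ge0.
  - by move=> x Nx; rewrite /q uE// wE.
pose a (p : V) : R := quot_re (u p) (w p) p.2.
pose b (p : V) : R := quot_im (u p) (w p) p.2.
have mt := @measurable_time R n.
have ma : measurable_fun setT a.
  apply: measurable_funM; last exact: measurable_oneDtimeV.
  by apply: measurable_funB => //; exact: measurable_funM.
have mb : measurable_fun setT b.
  apply: measurable_funM; last exact: measurable_oneDtimeV.
  by apply: measurable_funD => //; exact: measurable_funM.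
have aq p : a p ^+ 2 <= q p by exact: (quot_sqr_le _ _ _).1.
have bq p : b p ^+ 2 <= q p by exact: (quot_sqr_le _ _ _).2.
have weak s m k : \int[mu]_p cutoff_integrand a b s m k p = 0 /\
    \int[mu]_p cutoff_integrand b (fun p : V => - a p) s m k p = 0.
  have /eqP := phi_weak _ (@test_function_cutoff_test R n s m k).
  rewrite eq_complex /= => /andP[/eqP Re0 /eqP Im0].
  split; [rewrite -[RHS]Re0|rewrite -[RHS]Im0];
    apply: (eq_Rintegral_null mN N0) => p Np;
    rewrite mul_adjoint_cutoff_test /cutoff_integrand /a /b uE// wE//=; ring.
have moments := moments_eq0 j0 Wi ma mb aq bq (fun s m k => (weak s m k).1)
  (fun s m k => (weak s m k).2).
have a0 : {ae mu, forall p, a p = 0}.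
  by apply: (ae0_of_moments j0 Wi ma aq) => s m ms; exact: (moments s m ms).1.
have b0 : {ae mu, forall p, b p = 0}.
  by apply: (ae0_of_moments j0 Wi mb bq) => s m ms; exact: (moments s m ms).2.
have nN : {ae mu, forall p, ~ N p}.
  by exists N; split => // p /= /contrapT.
move: nN a0 b0; apply: filterS3 => p Np ap bp.
have [] := quot_eq0 ap bp; rewrite uE// wE//.
by case: (phi p) => x y /= -> ->.
Qed.
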